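(* Let $\mathbb{I}=\mathbb{N}^*$ or $\mathbb{I}=\mathbb{Z}$ and let $z\in\{-1,0,1\}^{\mathbb{I}}$. Then the conditions (Ch), (S$_0$-strong) and (S-strong) for $z$ are equivalent.
   Context: $\mathbb{N}^*=\{1,2,3,\dots\}$; sums $\sum_{n\le N}$ are over $1\le n\le N$. Condition (Ch) for $z$: for each choice of integers $1\le a_1<\dots<a_r$, $r\ge 0$, and exponents $i_0,i_1,\dots,i_r\in\{1,2\}$ not all equal to $2$, $$\frac1N\sum_{n\le N} z(n)^{i_0}\, z(n+a_1)^{i_1}\cdots z(n+a_r)^{i_r}\to 0\quad (N\to\infty).$$ Condition (S$_0$-strong) for $z$: for each homeomorphism $T$ of a compact metric space $X$ with topological entropy $h_{top}(T)=0$, each continuous function $f$ on $X$, each $x\in X$, and each choice of $1\le a_1<\dots<a_r$, $r\ge0$, $i_0,\dots,i_r\in\{1,2\}$ not all equal to $2$, $$\frac1N\sum_{n\le N} f(T^nx)\,z(n)^{i_0}\, z(n+a_1)^{i_1}\cdots z(n+a_r)^{i_r}\to 0\quad (N\to\infty).$$ Completely deterministic points: let $T$ be a homeomorphism of a compact metric space $X$ and $x\in X$. The point $x$ is completely deterministic if for every accumulation point $\nu$, in the weak topology on Borel probability measures (convergence of integrals of continuous functions), of the sequence $\left(\frac1N\sum_{n\le N}\delta_{T^nx}\right)_{N\ge1}$, the measure-theoretic (Kolmogorov–Sinai) entropy $h(T,\nu)$ is $0$. Condition (S-strong) for $z$: for each homeomorphism $T$ of a compact metric space $X$, each continuous function $f$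 on $X$, each completely deterministic $x\in X$, and each choice of $1\le a_1<\dots<a_r$, $r\ge0$, $i_0,\dots,i_r\in\{1,2\}$ not all equal to $2$, $$\frac1N\sum_{n\le N} f(T^nx)\,z(n)^{i_0}\, z(n+a_1)^{i_1}\cdots z(n+a_r)^{i_r}\to 0\quad (N\to\infty).$$ *)

(* Defs.v *)
From HB Require Import structures.
From mathcomp Require Import all_boot all_order all_algebra finmap.
From mathcomp Require Import all_classical all_reals all_analysis.

Set Implicit Arguments.
Unset Strict Implicit.
Unset Printing Implicit Defensive.

Import Order.TTheory GRing.Theory Num.Theory.
Import numFieldNormedType.Exports.

Local Open Scope classical_set_scope.
Local Open Scope ring_scope.

Definition homeomorphism {X : topologicalType} (T : X -> X) : Prop :=
  continuous T /\ exists S : X -> X, [/\ continuous S, cancel T S & cancel S T].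

Section topological_entropy.
Context {R : realType} {X : metricType R} (T : X -> X).

(* d_n(x, y) > e, where d_n(x, y) = max_(k < n) d(T^k x, T^k y). *)
Definition separated (n : nat) (e : R) (E : {fset X}) : Prop :=
  forall x y, x \in E -> y \in E -> x != y ->
    exists2 k : nat, (k < n)%N & e < mdist (iter k T x) (iter k T y).

Definition max_separated (n : nat) (e : R) : \bar R :=
  ereal_sup [set (#|` E|%:R)%:E | E in separated n e].

(* Bowen's definition; the outer limit is monotone in e. *)
Definition top_entropy : \bar R :=
  lim (limn_esup (fun n => (n%:R^-1)%:E * lne (max_separated n e))%E
        @[e --> 0^'+]).

End topological_entropy.

Section ks_entropy.
Context {R : realType} {d : measure_display} {Y : measurableType d}.
Variables (T : Y -> Y) (nu : probability Y R).

(* Cells of a partition may be empty. *)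
Definition measurable_partition (k : nat) (P : 'I_k -> set Y) : Prop :=
  [/\ forall j, measurable (P j), trivIset setT P & \bigcup_j P j = setT].

(* The cell of P \/ T^-1 P \/ ... \/ T^-(n-1) P with itinerary w. *)
Definition join_cell (k : nat) (P : 'I_k -> set Y) (n : nat)
    (w : {ffun 'I_n -> 'I_k}) : set Y :=
  \bigcap_(i in [set: 'I_n]) (iter i T @^-1` P (w i)).

(* Since ln 0 = 0, null cells contribute 0. *)
Definition join_entropy (k : nat) (P : 'I_k -> set Y) (n : nat) : R :=
  - \sum_(w : {ffun 'I_n -> 'I_k})
      fine (nu (join_cell P w)) * ln (fine (nu (join_cell P w))).

(* The limit exists by subadditivity when nu is T-invariant. *)
Definition partition_entropy (k : nat) (P : 'I_k -> set Y) : R :=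
  limn (fun n : nat => n%:R^-1 * join_entropy P n).

Definition ks_entropy : \bar R :=
  ereal_sup [set h | exists (k : nat) (P : 'I_k -> set Y),
    measurable_partition P /\ h = (partition_entropy P)%:E].

End ks_entropy.

(* measurableType requires a distinguished point; a point x of X is only    *)
(* used to provide it, and borel x is X with its Borel sigma-algebra.       *)
Definition pointed_at {X : topologicalType} (x : X) : Type := X.

HB.instance Definition _ (X : topologicalType) (x : X) :=
  Choice.on (pointed_at x).
HB.instance Definition _ (X : topologicalType) (x : X) :=
  isPointed.Build (pointed_at x) x.

Definition borel {X : topologicalType} (x : X) : Type :=
  g_sigma_algebraType (@open X : set (set (pointed_at x))).

HB.instance Definition _ (X : topologicalType) (x : X) :=
  Measurable.on (borel x).

Section weak_topology.
Context {R : realType} {X : topologicalType} (x : X).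

Definition integrals (nu : probability (borel x) R) :
    {ptws continuousType X R -> R} :=
  fun f => \int[nu]_(y in setT) (f y : R).

(* The coarsest topology making nu |-> \int f dnu continuous for every      *)
(* continuous f : X -> R.                                                   *)
Definition weak_probability := initial_topology integrals.

HB.instance Definition _ := Topological.on weak_probability.

End weak_topology.

Section empirical_measure.
Context {R : realType} {X : topologicalType} (T : X -> X) (x : X).

(* (1 / N) \sum_(1 <= n <= N) \d_(T^n x) with N = m.+1. *)
Definition empirical (m : nat) : set (borel x) -> \bar R :=
  mscale (m.+1%:R^-1)%:nng
    (msum (fun n : nat => \d_(iter n.+1 T x : borel x)) m.+1).

HB.instance Definition _ (m : nat) := Measure.on (empirical m).

Let empirical_setT (m : nat) : empirical m setT = 1%E.
Proof.
rewrite /empirical /mscale/= /msum.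
rewrite (eq_bigr (fun=> (1 : R)%:E)); last first.
  by move=> i _; rewrite /= diracE in_setT.
rewrite sumEFin -EFinM; congr EFin.
by rewrite sumr_const card_ord mulVf// pnatr_eq0.
Qed.

HB.instance Definition _ (m : nat) :=
  Measure_isProbability.Build _ _ _ (empirical m) (empirical_setT m).

Definition completely_deterministic : Prop :=
  forall nu : probability (borel x) R,
    cluster ((fun m => (empirical m : probability (borel x) R)
                        : weak_probability x) @ \oo)
      (nu : weak_probability x) ->
    ks_entropy (T : borel x -> borel x) nu = 0%E.

End empirical_measure.

Arguments completely_deterministic R {X} T x.

(* 1 <= a_1 < ... < a_r and i_0, ..., i_r in {1, 2} not all equal to 2; here *)
(* a_k and i_k for 1 <= k <= r are a and i at the ordinal k - 1.            *)
Definition admissible (r : nat) (a : 'I_r -> nat) (i0 : nat)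
    (i : 'I_r -> nat) : Prop :=
  [/\ forall k, (1 <= a k)%N,
      forall k l : 'I_r, (k < l)%N -> (a k < a l)%N,
      i0 \in [:: 1; 2]%N,
      forall k, i k \in [:: 1; 2]%N
    & ~ (i0 = 2%N /\ forall k, i k = 2%N)].

Section conditions.
Context {R : realType} (z : int -> R).

Definition correlation (r : nat) (a : 'I_r -> nat) (i0 : nat)
    (i : 'I_r -> nat) (n : nat) : R :=
  z n%:Z ^+ i0 * \prod_(k < r) z (n + a k)%N%:Z ^+ i k.

Definition Ch : Prop :=
  forall (r : nat) (a : 'I_r -> nat) (i0 : nat) (i : 'I_r -> nat),
    admissible a i0 i ->
    (N%:R^-1 * \sum_(1 <= n < N.+1) correlation a i0 i n)
      @[N --> \oo] --> (0 : R).

Definition orthogonal_to {X : metricType R} (T : X -> X) (f : X -> R)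
    (x : X) : Prop :=
  forall (r : nat) (a : 'I_r -> nat) (i0 : nat) (i : 'I_r -> nat),
    admissible a i0 i ->
    (N%:R^-1 * \sum_(1 <= n < N.+1) f (iter n T x) * correlation a i0 i n)
      @[N --> \oo] --> (0 : R).

Definition S0_strong : Prop :=
  forall (X : metricType R) (T : X -> X),
    compact [set: X] -> homeomorphism T -> top_entropy T = 0%E ->
    forall f : X -> R, continuous f -> forall x : X, orthogonal_to T f x.

Definition S_strong : Prop :=
  forall (X : metricType R) (T : X -> X),
    compact [set: X] -> homeomorphism T ->
    forall f : X -> R, continuous f ->
    forall x : X, completely_deterministic R T x -> orthogonal_to T f x.

End conditions.

(* Main.v *)
(* Either orthogonality condition gives Ch back by taking f = 1 on a one-point *)
(* space, so it suffices to derive both from Ch, which goes by     *)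
(* counting words.  Write W for the correlation and g(n) = f(T^n x).  Under    *)
(* Ch every product of distinct shifts of W has mean 0, because z^3 = z and    *)
(* the last odd exponent survives.  Hence prod_(h < m) (1 + t v_h W(n + h))    *)
(* has mean 1 for each fixed word v, and Markov's inequality bounds by         *)
(* 2 exp(- e^2 m / 8) the density of the n for which v correlates with W on    *)
(* n, ..., n + m - 1 by more than e.  The averages of g W therefore vanish as  *)
(* soon as exp(o(m)) words of length m approximate g near all but a density e  *)
(* of the integers.                                                            *)
(* When T has zero topological entropy, maximal separated sets give such       *)
(* words.  When x is completely deterministic, an ultrafilter limit of the     *)
(* empirical measures, built by the Daniell-Riesz construction, is an          *)
(* invariant measure of zero entropy, so a level partition of f has exp(o(m))  *)
(* cells of length m carrying almost all the mass, and the closed set of       *)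
(* points far from these cells is charged little by the empirical measures.    *)

Require Import Defs.
From HB Require Import structures.
From mathcomp Require Import all_boot all_order all_algebra finmap.
From mathcomp Require Import all_classical all_reals all_analysis.
From mathcomp Require Import measurable_realfun.
From mathcomp Require Import zify ring lra.

Set Implicit Arguments.
Unset Strict Implicit.
Unset Printing Implicit Defensive.

Import Order.TTheory GRing.Theory Num.Theory.
Import numFieldNormedType.Exports.

Local Open Scope classical_set_scope.
Local Open Scope ring_scope.

(** The heart of the proof is that under [Ch] the shifts of a correlation [W] behave, on average,
    like independent centred signs bounded by 1. Since z ^+ 3 = z on {-1, 0, 1}, a product of
    distinct shifts of [W] is again a shifted admissible correlation, so its mean is 0
    ([Ch_product]). Hence a fixed word v of length m satisfies a Chernoff bound: v has correlation
    at least e with the block of [W] at n only for a set of n of density at most 2 exp(- e^2 m / 8).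

    A union bound over k words survives as long as k is at most exp(e^2 m / 16) and m is large. So
    any bounded sequence g whose blocks of length m are, up to density e, uniformly e-close to one
    of that few words is orthogonal to [W]. This is [cvg_average_mul], and only the density
    condition is taken along a filter F, which may be finer than infinity.

    It remains to see that zero entropy yields few words. For zero topological entropy a maximal
    separated set shadows every orbit segment ([max_separated_subexp], [max_separated_spanning]).
    For a completely deterministic point, if orthogonality failed, an ultrafilter could be put on
    the bad lengths N. Along it the empirical measures converge to an invariant measure
    ([ultrafilter_measure]), which has entropy 0 by determinism, so that few cells carry most of its
    mass ([few_words]). A closed set and a continuous function dominating it carry this information
    back to the orbit. *)

Section average.
Context {R : realType}.
Implicit Types (u v : nat -> R) (c : R) (F : set_system nat).

(** * Cesaro averages and their invariance under shifts *)

Definition average u (N : nat) : R := N%:R^-1 * \sum_(1 <= n < N.+1) u n.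

Lemma eq_average u v : (forall n, (0 < n)%N -> u n = v n) ->
  average u = average v.
Proof.
move=> uv; apply/funext => N; congr (_ * _).
by apply: eq_big_nat => n /andP[n0 _]; exact: uv.
Qed.

Lemma averageD u v N : average (u \+ v) N = average u N + average v N.
Proof. by rewrite /average big_split/= mulrDr. Qed.

Lemma averageZ c u N : average (fun n => c * u n) N = c * average u N.
Proof. by rewrite /average -mulr_sumr mulrCA. Qed.

Lemma average_cst c N : average (fun=> c) N.+1 = c.
Proof.
by rewrite /average sumr_const_nat subn1 -[c *+ _]mulr_natl mulKf// pnatr_eq0.
Qed.

Lemma ler_average u v N : (forall n, (0 < n)%N -> u n <= v n) ->
  average u N <= average v N.
Proof.
move=> uv; rewrite ler_wpM2l// ?invr_ge0//.
by apply: ler_sum_nat => n /andP[n0 _]; exact: uv.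
Qed.

Lemma ler_norm_average u N : `|average u N| <= average (fun n => `|u n|) N.
Proof.
by rewrite normrM ger0_norm ?invr_ge0// ler_wpM2l// ?invr_ge0// ler_norm_sum.
Qed.

Lemma average_sum (I : Type) (s : seq I) (u : I -> nat -> R) N :
  average (fun n => \sum_(i <- s) u i n) N = \sum_(i <- s) average (u i) N.
Proof. by rewrite /average exchange_big/= mulr_sumr. Qed.

Lemma cvg_sum (I : Type) (s : seq I) (P : pred I) (u : I -> nat -> R)
    (l : I -> R) F : Filter F ->
  (forall i, P i -> u i N @[N --> F] --> l i) ->
  (\sum_(i <- s | P i) u i N) @[N --> F] --> \sum_(i <- s | P i) l i.
Proof. by move=> FF ul; apply: cvg_big => //; exact: add_continuous. Qed.

Lemma cvg_to_eq (T : Type) (G : set_system T) (f : T -> R) (l l' : R) :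
  f x @[x --> G] --> l' -> l' = l -> f x @[x --> G] --> l.
Proof. by move=> fl <-. Qed.

(** The two sums differ by h terms at each end, each bounded by M, so the difference is at most 2 h
    M / N. *)
Lemma average_shift u (M : R) h : (forall n, (0 < n)%N -> `|u n| <= M) ->
  average u N - average (fun n => u (n + h)%N) N @[N --> \oo] --> (0 : R).
Proof.
move=> uM; have M0 : 0 <= M by rewrite (le_trans _ (uM 1%N _)).
have -> : (fun N => average u N - average (fun n => u (n + h)%N) N) =
    (fun N => N%:R^-1 * (\sum_(1 <= n < h.+1) u n
                         - \sum_(1 <= n < h.+1) u (n + N)%N)).
  apply/funext => N; rewrite /average -mulrBr; congr (_ * _).
  have split_sum a b : \sum_(1 <= n < (a + b).+1) u n =
      \sum_(1 <= n < a.+1) u n + \sum_(1 <= n < b.+1) u (n + a)%N.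
    rewrite (big_cat_nat (n := a.+1))//=; last by rewrite ltnS leq_addr.
    congr (_ + _); rewrite -{1}[a.+1]add1n big_addn.
    by have -> : ((a + b).+1 - a = b.+1)%N by lia.
  by have := split_sum h N; rewrite addnC split_sum; lra.
apply: norm_cvg0.
apply: (@squeeze_cvgr _ _ _ _ (cst 0) (fun N => (h%:R * M *+ 2) * N%:R^-1)).
- apply: nearW => N; rewrite normr_ge0/= normrM ger0_norm ?invr_ge0//.
  rewrite mulrC ler_wpM2r// ?invr_ge0//.
  have bnd w : (forall n, (0 < n)%N -> `|w n| <= M) ->
      `|\sum_(1 <= n < h.+1) w n| <= h%:R * M.
    move=> wM; apply: le_trans (ler_norm_sum _ _ _) _.
    apply: (@le_trans _ _ (\sum_(1 <= n < h.+1) M)).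
      by apply: ler_sum_nat => n /andP[n0 _]; exact: wM.
    by rewrite sumr_const_nat subn1 mulr_natl.
  apply: le_trans (ler_normB _ _) _; rewrite mulr2n lerD//; apply: bnd => // n n0.
  by rewrite uM// addn_gt0 n0.
- exact: cvg_cst.
- rewrite -(mulr0 (h%:R * M *+ 2)); apply: cvgM; first exact: cvg_cst.
  by rewrite -cvg_shiftS; exact: cvg_harmonic.
Unshelve. all: end_near. Qed.

Lemma cvg_average_shift u (M l : R) h : (forall n, (0 < n)%N -> `|u n| <= M) ->
  average u N @[N --> \oo] --> l ->
  average (fun n => u (n + h)%N) N @[N --> \oo] --> l.
Proof.
move=> uM ul; rewrite -[l]subr0.
apply: cvg_trans (cvgB ul (average_shift h uM)).
by apply: near_eq_cvg; apply: nearW => N /=; rewrite subKr.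
Qed.

End average.

(** * Correlations as monomials in the shifts of z *)

Section chowla_monomials.
Context {R : realType} (z : int -> R).
Hypothesis z_sign : forall n : nat, (0 < n)%N -> z n \in [:: -1; 0; 1].

(** Exponents are recorded for all offsets below B, zero included, so that multiplying shifted
    correlations amounts to adding exponent functions. *)
Definition monomial (B : nat) (E : nat -> nat) (n : nat) : R :=
  \prod_(0 <= q < B) z (n + q)%N ^+ E q.

Lemma norm_z_le1 (n : nat) : (0 < n)%N -> `|z n| <= 1.
Proof.
by move=> /z_sign; rewrite !inE => /or3P[] /eqP ->; rewrite ?normrN ?normr1 ?normr0.
Qed.

Lemma norm_correlation_le1 r (a : 'I_r -> nat) i0 i n : (0 < n)%N ->
  `|correlation z a i0 i n| <= 1.
Proof.
move=> n0; rewrite /correlation normrM mulr_ile1 ?normr_ge0//.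
  by rewrite normrX exprn_ile1// norm_z_le1.
rewrite normr_prod; apply: prodr_ile1 => k _.
by rewrite normr_ge0/= normrX exprn_ile1// norm_z_le1// addn_gt0 n0.
Qed.

(** Normal form of an exponent under z ^+ 3 = z. The exponent 0 is kept apart from 2 because z may
    vanish. *)
Let reduced (e : nat) : nat := if e == 0%N then 0%N else if odd e then 1%N else 2%N.

Let z_reduced (n e : nat) : (0 < n)%N -> z n ^+ e = z n ^+ reduced e.
Proof.
move=> /z_sign; rewrite /reduced; case: e => // e.
rewrite !inE => /or3P[] /eqP -> /=.
- by rewrite -signr_odd /=; case: odd; rewrite ?expr0 ?expr1 ?sqrrN ?expr1n.
- by case: odd; rewrite ?expr0n.
- by rewrite !expr1n.
Qed.

Let reduced12 e : (0 < e)%N -> reduced e \in [:: 1; 2]%N.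
Proof. by rewrite /reduced; case: e => //= e _; case: odd. Qed.

Let reduced_odd e : odd e -> reduced e = 1%N.
Proof. by rewrite /reduced => oe; rewrite oe; case: e oe. Qed.

(* Starting at the least offset with a nonzero exponent and reducing exponents
   by z ^+ 3 = z turns the monomial into a shifted admissible correlation. *)
Lemma Ch_monomial B E p : Ch z -> (p < B)%N -> odd (E p) ->
  average (monomial B E) N @[N --> \oo] --> (0 : R).
Proof.
move=> chz pB oddp.
have [q0 /andP[q0B q0E] q0min] :
    exists2 q0, (q0 < B)%N && (0 < E q0)%N &
      forall q, (q < B)%N -> (0 < E q)%N -> (q0 <= q)%N.
  have exE : exists q, (q < B)%N && (0 < E q)%N by exists p; rewrite pB odd_gt0.
  exists (ex_minn exE); first by case: ex_minnP.
  by case: ex_minnP => q _ qmin q' q'B Eq'; apply: qmin; rewrite q'B.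
pose s := [seq j <- index_iota 1 (B - q0) | 0 < E (q0 + j)]%N.
pose a (k : 'I_(size s)) := nth 0%N s k.
pose i (k : 'I_(size s)) := reduced (E (q0 + a k)%N).
have a_s k : a k \in s by exact: mem_nth.
have adm : admissible a (reduced (E q0)) i.
  split.
  - by move=> k; have := a_s k; rewrite mem_filter mem_index_iota => /and3P[].
  - move=> k l kl; apply: (sorted_ltn_nth ltn_trans); rewrite ?inE//.
    by apply: sorted_filter; [exact: ltn_trans|exact: iota_ltn_sorted].
  - exact: reduced12.
  - move=> k; apply: reduced12.
    by have := a_s k; rewrite mem_filter => /andP[].
  (* The odd offset p prevents all exponents from being 2: either p = q0 and the leading exponent is
     1, or p - q0 occurs in [s] with exponent 1. *)
  - have q0p : (q0 <= p)%N by apply: q0min => //; exact: odd_gt0.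
    move=> [r0 rk]; have [eqp|nep] := eqVneq q0 p.
      by rewrite eqp reduced_odd in r0.
    have ps : (p - q0)%N \in s.
      rewrite mem_filter subnKC// odd_gt0//= mem_index_iota subn_gt0.
      by rewrite ltn_sub2r//= andbT ltn_neqAle nep.
    have := rk (Ordinal (etrans (index_mem _ _) ps)).
    by rewrite /i /a /= nth_index// subnKC// reduced_odd.
have monoE n : (0 < n)%N -> monomial B E n =
    correlation z a (reduced (E q0)) i (n + q0)%N.
  move=> n0; rewrite /monomial (big_cat_nat (n := q0)) ?(ltnW q0B)//=.
  rewrite big_nat big1 ?mul1r; last first.
    move=> q /andP[_ qq0]; have [|Eq] := posnP (E q); first by move=> ->.
    by have := q0min q (ltn_trans qq0 q0B) Eq; rewrite leqNgt qq0.
  rewrite big_ltn//; rewrite /correlation z_reduced ?addn_gt0 ?n0//; congr (_ * _).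
  transitivity (\prod_(j <- s) z (n + q0 + j)%N ^+ reduced (E (q0 + j)%N)).
    rewrite big_filter [RHS]big_mkcond/= -{1}[q0.+1]add1n big_addn.
    apply: eq_big_nat => j _; case: ifPn => [_|].
      by rewrite addnAC -addnA z_reduced ?addn_gt0 ?n0// addnA addnC [(j + q0)%N]addnC.
    by rewrite -eqn0Ngt addnC => /eqP ->.
  by rewrite (big_nth 0%N) big_mkord.
rewrite (@eq_average _ _ (fun n => correlation z a (reduced (E q0)) i (n + q0)%N))//.
apply: (@cvg_average_shift _ _ 1); last exact: chz.
by move=> n; exact: norm_correlation_le1.
Qed.

(** The offsets 0, a_1, ..., a_r are pairwise distinct, so exponents are never added up and an
    exponent 1 of the correlation remains an odd value of E. *)
Lemma correlation_monomial r (a : 'I_r -> nat) i0 i : admissible a i0 i ->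
  exists B E, [/\ correlation z a i0 i = monomial B E,
    forall q, (B <= q)%N -> E q = 0%N & exists p, odd (E p)].
Proof.
move=> [a1 a_incr i01 i1 not2].
pose B := (\max_(k < r) a k).+1.
have aB k : (a k < B)%N by rewrite ltnS (leq_bigmax k).
pose E q := ((q == 0%N) * i0 + \sum_(k < r) (a k == q) * i k)%N.
exists B, E; split.
- apply/funext => n; rewrite /monomial /E.
  under eq_bigr do rewrite exprD -prodrXr; rewrite big_split/=; congr (_ * _).
    rewrite big_nat_recl//= mul1n addn0 big1 ?mulr1//.
  rewrite exchange_big/=; apply: eq_bigr => k _.
  rewrite big_mkord (bigD1 (Ordinal (aB k)))//= eqxx mul1n big1 ?mulr1// => q.
  by rewrite -val_eqE/= eq_sym => /negPf ->.
- move=> q Bq; rewrite /E big1 ?addn0; first by case: q Bq.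
  by move=> k _; rewrite (negPf (_ : a k != q))// neq_ltn (leq_trans (aB k) Bq).
- have [[k ik]|noteven] := pselect (exists k, i k = 1%N).
    exists (a k); rewrite /E; have -> : (a k == 0%N) = false by have := a1 k; case: (a k).
    rewrite mul0n add0n (bigD1 k)//= eqxx ik big1// => l lk.
    rewrite (negPf (_ : a l != a k))//; apply/eqP => alk.
    have [/a_incr|/a_incr|/val_inj lk'] := ltngtP l k; rewrite ?alk ?ltnn//.
    by rewrite lk' eqxx in lk.
  have ik2 k : i k = 2%N.
    by have := i1 k; rewrite !inE => /orP[] /eqP// ik; case: noteven; exists k.
  have i0E : i0 = 1%N.
    by move: i01; rewrite !inE => /orP[] /eqP// i02; case: not2; split.
  exists 0%N; rewrite /E i0E big1// => k _.
  by have := a1 k; case: (a k).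
Qed.

(* The exponent at max S + p, for p the last odd offset of the correlation, is
   odd: the factor h = max S contributes an odd exponent, all others even. *)
Lemma Ch_product r (a : 'I_r -> nat) i0 i m (S : {set 'I_m}) :
  Ch z -> admissible a i0 i -> S != finset.set0 ->
  average (fun n => \prod_(h in S) correlation z a i0 i (n + h)%N) N
    @[N --> \oo] --> (0 : R).
Proof.
move=> chz adm S0; have [B [E [-> E0 oddE]]] := correlation_monomial adm.
have [p oddp pmax] : exists2 p, odd (E p) & forall q, (p < q)%N -> ~~ odd (E q).
  have Ebd q : odd (E q) -> (q <= B)%N.
    by move=> oq; rewrite leqNgt; apply/negP => /ltnW/E0 Eq0; rewrite Eq0 in oq.
  exists (ex_maxn oddE Ebd); first by case: ex_maxnP.
  case: ex_maxnP => p _ pmax q pq; apply/negP => /pmax.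
  by rewrite leqNgt pq.
have [h0 h0S h0max] : exists2 h0, h0 \in S & forall h, h \in S -> (h <= h0)%N.
  have /finset.set0Pn[h1 h1S] := S0.
  by case: (arg_maxnP (fun h : 'I_m => h : nat) h1S) => h0 h0S hm; exists h0.
pose E' q := (\sum_(h in S) if h <= q then E (q - h) else 0)%N.
have pB : (p < B)%N by rewrite ltnNge; apply/negP => /E0 Ep; rewrite Ep in oddp.
rewrite (@eq_average _ _ (monomial (m + B) E')); last first.
  move=> n n0; rewrite /monomial /E'.
  under [RHS]eq_bigr do rewrite -prodrXr; rewrite [RHS]exchange_big/=.
  apply: eq_bigr => h _; have hm : (h <= m)%N by exact: ltnW.
  apply/esym.
  rewrite (big_cat_nat (n := h)) ?(leq_trans hm) ?leq_addr//=.
  rewrite big_nat big1 ?mul1r; last first.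
    by move=> q /andP[_ qh]; rewrite leqNgt qh.
  rewrite (big_cat_nat (n := (h + B)%N)) ?leq_addr ?leq_add2r//=.
  rewrite [X in _ * X]big_nat [X in _ * X]big1 ?mulr1; last first.
    move=> q /andP[hq _]; rewrite (leq_trans _ hq) ?leq_addr// E0//.
    by rewrite leq_subRL ?(leq_trans _ hq) ?leq_addr.
  rewrite -[X in index_iota X _]add0n big_addn addnC addnK; apply: eq_bigr => q _.
  by rewrite leq_addl addnK -addnA [(h + q)%N]addnC.
apply: (@Ch_monomial _ _ (h0 + p)%N) => //; first by rewrite -addnS leq_add// ltnW.
rewrite /E' (bigD1 h0)//= leq_addr addKn oddD oddp/=.
elim/big_ind : _ => // [x y /negPf ox /negPf oy|h /andP[hS hh0]].
  by rewrite oddD ox oy.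
case: ifP => // _; apply: pmax.
have hlt : (h < h0)%N by rewrite ltn_neqAle hh0 h0max.
by lia.
Qed.

End chowla_monomials.

(** * Large deviations and the counting criterion *)

Section large_deviation.
Context {R : realType}.

(** Turns a product of factors 1 + s into the exponential of a sum. After inversion it is 1 + t <=
    exp t at t = 2 s^2 - s. *)
Lemma expR_le1D (s : R) : - 2^-1 <= s -> expR (s - 2 * s ^+ 2) <= 1 + s.
Proof.
move=> s2; rewrite -[s - _]opprK expRN -[leRHS]invrK lef_pV2 ?posrE ?expR_gt0//; last first.
  by rewrite invr_gt0; lra.
rewrite opprB (le_trans _ (expR_ge1Dx _))// -div1r ler_pdivrMr; last by lra.
have -> : (1 + (2 * s ^+ 2 - s)) * (1 + s) = 1 + s ^+ 2 * (1 + 2 * s) by ring.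
by rewrite lerDl mulr_ge0 ?sqr_ge0//; lra.
Qed.

(** Chernoff's bound with tilt e / 4: the logarithm of the product is at least (e / 4) e m - 2 (e /
    4)^2 m = e^2 m / 8. *)
Lemma prod_deviation m (x : 'I_m -> R) (e : R) : 0 < e -> e <= 1 ->
  (forall h, `|x h| <= 1) -> e * m%:R <= \sum_h x h ->
  1 <= expR (- (e ^+ 2 * m%:R / 8)) * \prod_h (1 + e / 4 * x h).
Proof.
move=> e0 e1 x1 ex; have ex2 h : - 2^-1 <= e / 4 * x h /\ x h ^+ 2 <= 1.
  have := x1 h; rewrite ler_norml => /andP[xl xr].
  by split; nra.
apply: (@le_trans _ _ (expR (- (e ^+ 2 * m%:R / 8)) *
    \prod_h expR (e / 4 * x h - 2 * (e / 4 * x h) ^+ 2))); last first.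
  rewrite ler_pM2l ?expR_gt0//; apply: ler_prod => h _.
  by rewrite expR_ge0/= expR_le1D//; case: (ex2 h).
rewrite -expR_sum -expRD -[leLHS]expR0 ler_expR.
apply: (@le_trans _ _ (- (e ^+ 2 * m%:R / 8) + (e / 4 * \sum_h x h
    - m%:R * (e ^+ 2 / 8)))).
  by have : 0 <= m%:R :> R := ler0n _ _; nra.
rewrite lerD2l; have -> : m%:R * (e ^+ 2 / 8) = \sum_(h < m) (e ^+ 2 / 8).
  by rewrite sumr_const card_ord mulr_natl.
rewrite mulr_sumr -sumrB; apply: ler_sum => h _; rewrite lerD2l lerN2.
by have [_] := ex2 h; rewrite exprMn => xh; nra.
Qed.

Variables (F : set_system nat) (W g : nat -> R).
Hypothesis FF : ProperFilter F.
Hypothesis F_oo : F --> \oo.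
Hypothesis W1 : forall n, (0 < n)%N -> `|W n| <= 1.
Hypothesis g1 : forall n, `|g n| <= 1.
Hypothesis W_prod : forall m (S : {set 'I_m}), S != finset.set0 ->
  average (fun n => \prod_(h in S) W (n + h)%N) N @[N --> \oo] --> (0 : R).

Let cvg_average_cst (c : R) : average (fun=> c) N @[N --> \oo] --> c.
Proof. by rewrite -cvg_shiftS; under eq_fun do rewrite average_cst; exact: cvg_cst. Qed.

(** Expanding the product over subsets J of the block, every nonempty J has mean 0 and the empty one
    contributes 1. *)
Lemma cvg_average_prod m (c : 'I_m -> R) :
  average (fun n => \prod_h (1 + c h * W (n + h)%N)) N @[N --> \oo] --> (1 : R).
Proof.
have -> : (fun n => \prod_h (1 + c h * W (n + h)%N)) =
    (fun n => \sum_(J : {set 'I_m}) ((\prod_(h in J) c h) *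
                                    \prod_(h in J) W (n + h)%N)).
  apply/funext => n; under eq_bigr do rewrite addrC.
  rewrite bigA_distr; apply: eq_bigr => J _.
  by rewrite -big_split/= [RHS]big_mkcond.
under eq_fun do rewrite average_sum.
have sum1 : \sum_(J : {set 'I_m}) (J == finset.set0)%:R = 1 :> R.
  by rewrite (bigD1 finset.set0)//= eqxx big1 ?addr0// => J /negPf ->.
apply: cvg_to_eq sum1.
apply: cvg_sum => J _; under eq_fun do rewrite averageZ.
have [->|J0] := eqVneq J finset.set0.
  rewrite big_set0; under eq_fun do rewrite mul1r.
  rewrite (@eq_average _ _ (fun=> 1)); first exact: cvg_average_cst.
  by move=> n _; rewrite big_set0.
apply: cvg_to_eq (mulr0 (\prod_(h in J) c h)).
by apply: cvgM; [exact: cvg_cst|exact: W_prod].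
Qed.

Definition far_from (e : R) m k (v : 'I_k -> nat -> R) : set nat :=
  [set n | forall j, exists2 h, (h < m)%N & e < `|g (n + h)%N - v j h|].

(** If n is not far from the words, some word v_j is e-close to g on the block, and replacing g by
    v_j costs e. Then either v_j correlates with [W] by less than e, giving 2 e in all, or
    [prod_deviation] makes one of the two products, according to the sign of the deviation, large
    enough for the last term to exceed the trivial bound 1. *)
Lemma block_average_le (e : R) m k (v : 'I_k -> nat -> R) n :
  0 < e -> e <= 1 -> (0 < n)%N -> (0 < m)%N -> (forall j h, `|v j h| <= 1) ->
  `|m%:R^-1 * \sum_(h < m) g (n + h)%N * W (n + h)%N| <=
    2 * e + \1_(far_from e m v) n + expR (- (e ^+ 2 * m%:R / 8)) *
      \sum_j (\prod_(h < m) (1 + e / 4 * v j h * W (n + h)%N) +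
              \prod_(h < m) (1 + - (e / 4 * v j h) * W (n + h)%N)).
Proof.
move=> e0 e1 n0 m0 v1; set P := \sum_(j < k) _.
have Wn1 h : `|W (n + h)%N| <= 1 by rewrite W1// addn_gt0 n0.
have vW1 j h : `|v j h * W (n + h)%N| <= 1 by rewrite normrM mulr_ile1.
have mp : 0 < m%:R :> R by rewrite ltr0n.
have norm_block_le (u : nat -> R) b : (forall h, (h < m)%N -> `|u h| <= b) ->
    `|m%:R^-1 * \sum_(h < m) u h| <= b.
  move=> ub; rewrite normrM gtr0_norm ?invr_gt0// ler_pdivrMl// mulr_natl.
  apply: le_trans (ler_norm_sum _ _ _) _.
  rewrite -[X in _ *+ X]card_ord -sumr_const; apply: ler_sum => h _.
  exact: ub.
have le1 : `|m%:R^-1 * \sum_(h < m) g (n + h)%N * W (n + h)%N| <= 1.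
  apply: (norm_block_le (fun h => g (n + h)%N * W (n + h)%N)) => h _.
  by rewrite normrM mulr_ile1.
have P_ge0 j : 0 <= \prod_(h < m) (1 + e / 4 * v j h * W (n + h)%N) /\
    0 <= \prod_(h < m) (1 + - (e / 4 * v j h) * W (n + h)%N).
  by split; apply: prodr_ge0 => h _; have := vW1 j h; rewrite ler_norml => /andP[];
    rewrite ?mulNr -mulrA; nra.
have P0 : 0 <= expR (- (e ^+ 2 * m%:R / 8)) * P.
  rewrite mulr_ge0 ?expR_ge0//; apply: sumr_ge0 => j _.
  by have [? ?] := P_ge0 j; exact: addr_ge0.
rewrite indicE; have [_|] := boolP (n \in far_from e m v).
  by rewrite (le_trans le1)//=; lra.
rewrite notin_setE => /existsNP[j close]; rewrite addr0.
have gv h : (h < m)%N -> `|g (n + h)%N - v j h| <= e.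
  by move=> hm; rewrite leNgt; apply/negP => ?; apply: close; exists h.
have [small|big] := ltP `|\sum_(h < m) v j h * W (n + h)%N| (e * m%:R).
  rewrite -[leLHS]addr0 lerD//.
  have -> : m%:R^-1 * \sum_(h < m) g (n + h)%N * W (n + h)%N =
      m%:R^-1 * \sum_(h < m) (g (n + h)%N - v j h) * W (n + h)%N +
      m%:R^-1 * \sum_(h < m) v j h * W (n + h)%N.
    by rewrite -mulrDr -big_split/=; congr (_ * _); apply: eq_bigr => h _; ring.
  rewrite (le_trans (ler_normD _ _))// mulr2n mulrDl mul1r lerD//.
    apply: (norm_block_le (fun h => (g (n + h)%N - v j h) * W (n + h)%N)) => h hm.
    by rewrite normrM -[leRHS]mulr1 ler_pM// gv.
  by rewrite normrM gtr0_norm ?invr_gt0// ler_pdivrMl// mulrC ltW.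
rewrite (le_trans le1)// -[leLHS]add0r lerD//; first by rewrite mulr_ge0 ?ltW.
rewrite (@le_trans _ _ (expR (- (e ^+ 2 * m%:R / 8)) *
    (\prod_(h < m) (1 + e / 4 * v j h * W (n + h)%N) +
     \prod_(h < m) (1 + - (e / 4 * v j h) * W (n + h)%N))))//; last first.
  rewrite ler_pM2l ?expR_gt0// /P (bigD1 j)//= lerDl; apply: sumr_ge0 => i _.
  by have [? ?] := P_ge0 i; exact: addr_ge0.
move: big; rewrite ler_normr mulrDr => /orP[|] big.
  apply: (le_trans (prod_deviation e0 e1 _ big)) => //.
  under eq_bigr do rewrite mulrA.
  by rewrite lerDl mulr_ge0 ?expR_ge0//; case: (P_ge0 j).
rewrite -sumrN in big.
apply: (le_trans (prod_deviation e0 e1 _ big)); first by move=> h; rewrite normrN.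
under eq_bigr do rewrite mulrN mulrA -mulNr.
by rewrite lerDr mulr_ge0 ?expR_ge0//; case: (P_ge0 j).
Qed.

(** By shift invariance the average of g W is that of its block means, to which [block_average_le]
    applies termwise. The mean of the products tends to 2 k, and the assumed bound on k makes their
    total contribution small. *)
Lemma cvg_average_mul :
  (forall e : R, 0 < e -> e <= 1 ->
    exists m k (v : 'I_k -> nat -> R), [/\ (0 < m)%N,
      forall j h, `|v j h| <= 1,
      k%:R * expR (- (e ^+ 2 * m%:R / 8)) <= e &
      \forall N \near F, average \1_(far_from e m v) N <= e]) ->
  average (fun n => g n * W n) N @[N --> F] --> (0 : R).
Proof.
move=> words; apply/cvgrPdist_le => d d0.
(* The budget is 8 e: e for passing to blocks, 2 e + e for the constant term and its error, e for
   the far integers, and 2 e + e for the deviation products and their error. *)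
pose e := Num.min 1 (d / 8).
have e0 : 0 < e by rewrite lt_min ltr01/= divr_gt0.
have e1 : e <= 1 by rewrite ge_min lexx.
have ed : 8 * e <= d by rewrite -ler_pdivlMl// mulrC ge_min lexx orbT.
have [m [k [v [m0 v1 vk far]]]] := words e e0 e1.
pose K := expR (- (e ^+ 2 * m%:R / 8)).
pose gW n := g n * W n.
have gW1 n : (0 < n)%N -> `|gW n| <= 1 by move=> n0; rewrite normrM mulr_ile1// W1.
pose block n := m%:R^-1 * \sum_(h < m) gW (n + h)%N.
have block_cvg : average gW N - average block N @[N --> \oo] --> (0 : R).
  have -> : (fun N => average gW N - average block N) =
      (fun N => m%:R^-1 * \sum_(h < m)
        (average gW N - average (fun n => gW (n + h)%N) N)).
    apply/funext => N; rewrite sumrB sumr_const card_ord -average_sum mulrBr.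
    by rewrite -[average gW N *+ m]mulr_natl mulKf ?pnatr_eq0 -?lt0n// /block averageZ.
  apply: cvg_to_eq (mulr0 m%:R^-1); apply: cvgM; first exact: cvg_cst.
  apply: (@cvg_to_eq _ _ _ _ _ (\sum_(h < m) 0)); last by rewrite big1.
  by apply: cvg_sum => h _; exact: average_shift gW1.
pose dev_word j n := \prod_(h < m) (1 + e / 4 * v j h * W (n + h)%N) +
              \prod_(h < m) (1 + - (e / 4 * v j h) * W (n + h)%N).
pose dev n := \sum_(j < k) dev_word j n.
have dev_cvg : K * average dev N @[N --> \oo] --> K * (k%:R * 2).
  apply: cvgM; first exact: cvg_cst.
  rewrite (_ : k%:R * 2 = \sum_(j < k) 2 :> R); last first.
    by rewrite sumr_const card_ord mulr_natl.
  have -> : average dev = fun N => \sum_(j < k) average (dev_word j) N.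
    by apply/funext => N; rewrite -average_sum.
  by apply: cvg_sum => j _; under eq_fun do rewrite averageD; apply: cvgD;
    exact: cvg_average_prod.
have cst_cvg : average (fun=> 2 * e) N @[N --> \oo] --> 2 * e by exact: cvg_average_cst.
have near_oo (P : set nat) : (\forall N \near \oo, P N) -> \forall N \near F, P N.
  by move=> ?; exact: F_oo.
have /cvgrPdist_le/(_ e e0)/near_oo block_near := block_cvg.
have /cvgrPdist_le/(_ e e0)/near_oo dev_near := dev_cvg.
have /cvgrPdist_le/(_ e e0)/near_oo cst_near := cst_cvg.
near=> N.
have block_le : `|average gW N - average block N| <= e.
  by rewrite -normrN -sub0r; near: N.
have dev_le : `|K * (k%:R * 2) - K * average dev N| <= e by near: N.
have cst_le : `|2 * e - average (fun=> 2 * e) N| <= e by near: N.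
have far_le : average \1_(far_from e m v) N <= e by near: N.
rewrite sub0r normrN -[average _ N](subrK (average block N)).
rewrite (le_trans (ler_normD _ _))//.
have block_bound : `|average block N| <= average (fun=> 2 * e) N +
    average \1_(far_from e m v) N + K * average dev N.
  rewrite -averageZ -!averageD (le_trans (ler_norm_average _ _))//.
  by apply: ler_average => n n0; exact: block_average_le.
apply: le_trans (lerD block_le block_bound) _.
move: dev_le cst_le; rewrite !ler_norml => /andP[dev_le _] /andP[cst_le _].
by rewrite -/K in vk; lra.
Unshelve. all: end_near. Qed.

End large_deviation.

(** * Zero topological entropy *)

Section topological_words.
Context {R : realType} {X : metricType R} (T : X -> X).

Lemma compact_unif_continuous (f : X -> R) : compact [set: X] -> continuous f ->
  forall e : R, 0 < e -> exists2 d : R, 0 < d &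
    forall x y, mdist x y <= d -> `|f x - f y| <= e.
Proof.
move=> /compact_near_coveringP cptX fc e e0.
pose P (d : R) x := forall y, mdist x y <= d -> `|f x - f y| <= e.
have : \forall d \near 0^'+, [set: X] `<=` P d.
  apply: cptX => x _.
  have /cvgrPdist_lt/(_ (e / 2)) := fc x; rewrite divr_gt0// => /(_ isT).
  move=> /nbhs_ballP[r /= r0 fxr]; rewrite ballEmdist in fxr.
  exists (ball x (r / 2), [set d : R | d < r / 2]) => /=.
    split; first by apply: nbhsx_ballx; rewrite divr_gt0.
    by apply: nbhs_right_lt; rewrite divr_gt0.
  move=> [x' d]/= [xx' dr] y x'y; rewrite ballEmdist/= in xx'.
  have fx' : `|f x - f x'| < e / 2 by apply: fxr => /=; lra.
  have fy : `|f x - f y| < e / 2.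
    by apply: fxr => /=; have := metric_triangle x x' y; lra.
  rewrite (le_trans (ler_distD (f x) _ _))// distrC.
  by move: fx' fy; lra.
move=> PT; have [d [d0 Pd]] : exists d : R, 0 < d /\ [set: X] `<=` P d.
  have : \forall d \near (0 : R)^'+, 0 < d /\ [set: X] `<=` P d.
    by near=> d; split => //; near: d.
  by move=> /filter_ex[d ?]; exists d.
by exists d => // x y; exact: Pd.
Unshelve. all: end_near. Qed.

Lemma le_max_separated n (e e' : R) : e <= e' ->
  (max_separated T n e' <= max_separated T n e)%E.
Proof.
move=> ee'; apply: ereal_sup_le => _ [E sepE <-]; exists E => // x y xE yE xy.
by have [k kn e'k] := sepE x y xE yE xy; exists k => //; exact: le_lt_trans e'k.
Qed.

Lemma max_separated_ge0 n (e : R) : (0 <= max_separated T n e)%E.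
Proof.
apply: ereal_sup_ubound => /=; exists fset0 => [x y|]; first by rewrite inE.
by rewrite cardfs0.
Qed.

(** The growth rate increases as the scale decreases, so the outer limit defining the entropy is a
    supremum, and entropy 0 bounds the rate at every fixed scale d. *)
Lemma max_separated_subexp (d eta : R) : top_entropy T = 0%E -> 0 < d ->
  0 < eta -> \forall n \near \oo, (max_separated T n d <= (expR (eta * n%:R))%:E)%E.
Proof.
pose u (e : R) n := ((n%:R^-1)%:E * lne (max_separated T n e))%E.
have lne_le n (e e' : R) : e <= e' -> (u e' n <= u e n)%E.
  move=> ee'; apply: lee_wpmul2l; first by rewrite lee_fin.
  by rewrite lee_lne ?le_max_separated// in_itv/= max_separated_ge0 leey.
move=> h0 d0 eta0; have : (limn_esup (u d) <= 0)%E.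
  rewrite -[leRHS]h0 /top_entropy -/(u _).
  have mono : {in `]0, +oo[ &,
      {homo (fun e => limn_esup (u e)) : e e' / e <= e' >-> (e' <= e)%E}}.
    move=> e e' _ _ ee'; apply: le_ereal_inf_tmp => _ [A ooA <-].
    apply: (@le_trans _ _ (ereal_sup (u e' @` A))).
      by apply: ereal_inf_lbound; exists A.
    apply: ge_ereal_sup => _ [n An <-].
    by apply: (le_trans (lne_le n _ _ ee')); apply: ereal_sup_ubound; exists n.
  have /cvg_lim -> // := nonincreasing_at_right_cvge (BInfty _ false) (erefl _) mono.
  by apply: ereal_sup_ubound; exists d => //=; rewrite in_itv/= d0.
move=> /le_lt_trans/(_ (_ : 0%:E < eta%:E)%E); rewrite lte_fin => /(_ eta0).
move=> /ereal_inf_lt[_ [A ooA <-] supA].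
near=> n; have n0 : (0 < n)%N by near: n; exact: nbhs_infty_gt.
have : (u d n < eta%:E)%E.
  apply: le_lt_trans supA; apply: ereal_sup_ubound; exists n => //.
  by near: n.
(* An infinite value is excluded because it would make [u d n] infinite. *)
rewrite /u; have := max_separated_ge0 n d.
case: (max_separated T n d) => [r||]//=; last first.
  by rewrite mulry gtr0_sg ?mul1e// invr_gt0 ltr0n.
case: ifPn => [r0 _ _|]; first by rewrite lee_fin (le_trans r0)// expR_ge0.
rewrite -ltNge => r0 _; rewrite -EFinM lte_fin mulrC ltr_pdivrMr ?ltr0n// => rn.
by rewrite lee_fin -[leLHS]lnK// ler_expR ltW.
Unshelve. all: end_near. Qed.

(** A separated set of maximal cardinality spans: a point not shadowed by it could be added to it. A
    maximum exists because c bounds all cardinalities. *)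
Lemma max_separated_spanning m (d c : R) : 0 < d ->
  (max_separated T m d <= c%:E)%E -> exists2 E : {fset X}, #|` E|%:R <= c &
    forall y, exists2 x, x \in E &
      forall k, (k < m)%N -> mdist (iter k T x) (iter k T y) <= d.
Proof.
move=> d0 sep_c.
have card_le (E : {fset X}) : Defs.separated T m d E -> #|` E|%:R <= c.
  move=> sepE; rewrite -lee_fin (le_trans _ sep_c)//.
  by apply: ereal_sup_ubound; exists E.
pose P n := `[< exists2 E : {fset X}, Defs.separated T m d E & #|` E| = n >].
have exP : exists n, P n.
  exists 0%N; apply/asboolP; exists fset0; last by rewrite cardfs0.
  by move=> x y; rewrite inE.
have bdP n : P n -> (n <= Num.truncn c)%N.
  move=> /asboolP[E /card_le Ec <-].
  by rewrite truncn_ge_nat// (le_trans _ Ec).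
case: (ex_maxnP exP bdP) => n /asboolP[E sepE En] maxn.
exists E => [|y]; first exact: card_le.
apply: contrapT => nospan.
have yE : y \notin E.
  apply/negP => yE; apply: nospan; exists y => // k _.
  by rewrite mdistxx ltW.
have far x : x \in E -> exists2 k, (k < m)%N & d < mdist (iter k T x) (iter k T y).
  move=> xE; apply: contrapT => close; apply: nospan; exists x => // k km.
  by rewrite leNgt; apply/negP => ?; apply: close; exists k.
suff : P n.+1 by move=> /maxn; rewrite ltnn.
apply/asboolP; exists (y |` E)%fset; last by rewrite cardfsU1 yE En.
move=> x x' /fset1UP[->|xE] /fset1UP[->|x'E] xx'.
- by rewrite eqxx in xx'.
- by have [k km dk] := far _ x'E; exists k => //; rewrite metric_sym.
- exact: far.
- exact: sepE.
Qed.

End topological_words.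

(** * The Daniell-Riesz construction *)

Section metric_functions.
Context {R : realType} {X : metricType R}.

Lemma lipschitz_continuous (f : X -> R) :
  (forall x y, f x <= f y + mdist x y) -> continuous f.
Proof.
move=> fL x; apply/cvgrPdist_lt => e e0; near=> y.
have xy : mdist x y < e.
  have : ball x e y by near: y; exact: nbhsx_ballx.
  by rewrite ballEmdist.
rewrite ltr_norml; have := fL x y; have := fL y x; rewrite metric_sym.
by move: xy; lra.
Unshelve. all: end_near. Qed.

Lemma continuous_fun_min (f g : X -> R) : continuous f -> continuous g ->
  continuous (fun y => Num.min (f y) (g y)).
Proof. by move=> fc gc y; apply: continuous_min; [exact: fc|exact: gc]. Qed.

Lemma continuous_fun_max (f g : X -> R) : continuous f -> continuous g ->
  continuous (fun y => Num.max (f y) (g y)).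
Proof. by move=> fc gc y; apply: continuous_max; [exact: fc|exact: gc]. Qed.

Lemma open_indicator_approx (O : set X) : open O ->
  exists g : nat -> X -> R, [/\ forall n, continuous (g n),
    forall n y, 0 <= g n y <= 1,
    forall y, {homo (fun n => g n y) : n m / (n <= m)%N >-> n <= m},
    forall n y, ~ O y -> g n y = 0 &
    forall y, O y -> \forall n \near \oo, g n y = 1].
Proof.
(* Distance to the complement, capped at 1 so that the infimum is over a nonempty set even when O is
   the whole space. The functions min(1, n dO) then increase to the indicator of O. *)
move=> oO; pose dO y : R := inf [set t | t = 1 \/ exists2 z, ~ O z & t = mdist y z].
have dO_lb y : lbound [set t | t = 1 \/ exists2 z, ~ O z & t = mdist y z] 0.
  by move=> t [->|[z _ ->]]; rewrite ?ler01 ?mdist_ge0.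
have dO_ge0 y : 0 <= dO y.
  by apply: lb_le_inf; [exists 1; left|exact: dO_lb].
have dO_c : continuous dO.
  apply: lipschitz_continuous => y y'; rewrite -lerBlDr.
  apply: lb_le_inf; first by exists 1; left.
  move=> t [->|[z Oz ->]]; rewrite lerBlDr.
    apply: (@le_trans _ _ 1); last by rewrite lerDl mdist_ge0.
    by apply: ge_inf; [exists 0; exact: dO_lb|left].
  apply: (@le_trans _ _ (mdist y z)).
    by apply: ge_inf; [exists 0; exact: dO_lb|right; exists z].
  by rewrite addrC metric_triangle.
have dO_out y : ~ O y -> dO y = 0.
  move=> Oy; apply/eqP; rewrite eq_le dO_ge0 andbT.
  apply: ge_inf; first by exists 0; exact: dO_lb.
  by right; exists y => //; rewrite mdistxx.
have dO_in y : O y -> 0 < dO y.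
  move=> Oy; have /nbhs_ballP[r /= r0 rO] := open_nbhs_nbhs (conj oO Oy).
  apply: (@lt_le_trans _ _ (Num.min 1 r)); first by rewrite lt_min ltr01.
  apply: lb_le_inf; first by exists 1; left.
  move=> t [->|[z Oz ->]]; rewrite ge_min ?lexx//; apply/orP; right.
  by rewrite leNgt; apply/negP => yz; apply: Oz; apply: rO; rewrite ballEmdist.
exists (fun n y => Num.min 1 (n%:R * dO y)); split.
- move=> n; apply: continuous_fun_min; first by move=> y; exact: cvg_cst.
  by move=> y; apply: cvgM; [exact: cvg_cst|exact: dO_c].
- by move=> n y; rewrite le_min ge_min lexx ler01 mulr_ge0.
- by move=> y n m nm; rewrite le_min2// ler_wpM2r// ler_nat.
- by move=> n y /dO_out ->; rewrite mulr0 min_r.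
- move=> y /dO_in dy; near=> n; apply/min_idPl.
  rewrite -ler_pdivrMr// mul1r; near: n; exact: nbhs_infty_ger.
Unshelve. all: end_near. Qed.

End metric_functions.

Section borel_functions.
Context {R : realType} {X : topologicalType} (x0 : X).

Lemma open_borel (A : set X) : open A -> measurable (A : set (borel x0)).
Proof. by move=> oA; exact: sub_gen_smallest. Qed.

Lemma closed_borel (A : set X) : closed A -> measurable (A : set (borel x0)).
Proof.
by move=> clA; rewrite -(setCK A); apply: measurableC; apply: open_borel; rewrite openC.
Qed.

Lemma continuous_borel_measurable (f : X -> R) :
  continuous f -> measurable_fun setT (f : borel x0 -> R).
Proof.
move=> /continuousP fc; apply: (measurability _ (RGenOpens.measurableE R)).
move=> _ [_ [a [b ->] <-]]; rewrite setTI.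
by apply: open_borel; apply: fc; exact: interval_open.
Qed.

Lemma continuous_borel_map (T : X -> X) :
  continuous T -> measurable_fun setT (T : borel x0 -> borel x0).
Proof.
move=> /continuousP Tc; apply: (measurability (@open X : set (set (borel x0)))) => //.
by move=> _ [A oA <-]; rewrite setTI; apply: open_borel; exact: Tc.
Qed.

Lemma compact_continuous_bounded (f : X -> R) : compact [set: X] -> continuous f ->
  exists2 M : nat, (0 < M)%N & forall y, `|f y| <= M%:R.
Proof.
move=> cptX fc; have : compact (f @` [set: X]).
  by apply: continuous_compact => //; exact: continuous_subspaceT.
move=> /compact_bounded bounded_f.
have [M fM] : exists M : R, globally (f @` [set: X]) [set y | `|y| <= M].
  exact: (@filter_ex _ +oo).
exists (Num.truncn M).+1 => // y; apply: le_trans (fM _ _) _; first by exists y.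
exact/ltW/truncnS_gt.
Qed.

Lemma bounded_continuous_integrable (P : probability (borel x0) R) (f : X -> R) M :
  continuous f -> (forall y, `|f y| <= M) ->
  P.-integrable setT (EFin \o (f : borel x0 -> R)).
Proof.
move=> fc fM; apply: measurable_bounded_integrable => //.
- by apply: (le_lt_trans (probability_le1 P measurableT)); exact: ltry.
- exact: continuous_borel_measurable.
- exists M; split; first exact: num_real.
  by move=> N MN y _; exact: le_trans (fM y) (ltW MN).
Qed.

End borel_functions.

Section clamp.
Context {R : realDomainType}.

(** [clamp (t - j%:R)] is the part of t between the heights j and j + 1; [sum_clamp] stacks these
    unit layers. *)
Definition clamp (t : R) : R := Num.min (Num.max t 0) 1.

Lemma clamp_ge0 t : 0 <= clamp t.
Proof. by rewrite le_min le_max lexx orbT ler01. Qed.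

Lemma clamp_eq1 t : 1 <= t -> clamp t = 1.
Proof. by move=> t1; rewrite /clamp min_r// le_max t1. Qed.

Lemma clamp_le_indic t : clamp t <= (0 < t)%R%:R.
Proof. by rewrite ge_min ge_max; have [_|t0] := ltP 0 t; rewrite ?lexx ?orbT ?t0. Qed.

Lemma sum_clamp t N : \sum_(j < N) clamp (t - j%:R) = Num.min (Num.max t 0) N%:R.
Proof.
elim: N => [|N IH]; first by rewrite big_ord0 min_r// le_max lexx orbT.
rewrite big_ord_recr/= IH /clamp -natr1.
have N0 : 0 <= N%:R :> R by [].
have [t0|t0] := leP t 0; have [tN|tN] := leP (t - N%:R) 0;
  repeat (case: (leP _ _) => ?); lra.
Qed.

End clamp.

(** The functional is total on functions but constrained on continuous ones only, so that a limit of
    orbit averages fits directly. *)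
Definition positive_functional {R : realType} {X : topologicalType}
    (L : (X -> R) -> R) : Prop :=
  [/\ forall f g : X -> R, continuous f -> continuous g ->
        L (fun y => f y + g y) = L f + L g,
      forall c (f : X -> R), continuous f -> L (fun y => c * f y) = c * L f,
      forall f : X -> R, continuous f -> (forall y, 0 <= f y) -> 0 <= L f &
      L (fun=> 1) = 1].

Section daniell.
Context {R : realType} {X : metricType R} (x0 : X).
Variable L : (X -> R) -> R.
Hypothesis cptX : compact [set: X].
Hypothesis L_pos : positive_functional L.

Let LD (f g : X -> R) : continuous f -> continuous g ->
  L (fun y => f y + g y) = L f + L g.
Proof. by case: L_pos => + _ _ _; exact. Qed.

Let LZ c (f : X -> R) : continuous f -> L (fun y => c * f y) = c * L f.
Proof. by case: L_pos => _ + _ _; exact. Qed.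

Let L_ge0 (f : X -> R) : continuous f -> (forall y, 0 <= f y) -> 0 <= L f.
Proof. by case: L_pos => _ _ + _; exact. Qed.

Let L_one : L (fun=> 1) = 1.
Proof. by case: L_pos. Qed.

Let cst_c (c : R) : continuous (fun _ : X => c).
Proof. by move=> y; exact: cvg_cst. Qed.

Let mul_c (f g : X -> R) : continuous f -> continuous g ->
  continuous (fun y => f y * g y).
Proof. by move=> fc gc y; apply: cvgM; [exact: fc|exact: gc]. Qed.

Let add_c (f g : X -> R) : continuous f -> continuous g ->
  continuous (fun y => f y + g y).
Proof. by move=> fc gc y; apply: cvgD; [exact: fc|exact: gc]. Qed.

Let sub_c (f g : X -> R) : continuous f -> continuous g ->
  continuous (fun y => f y - g y).
Proof. by move=> fc gc y; apply: cvgB; [exact: fc|exact: gc]. Qed.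

Lemma functional_cst c : L (fun=> c) = c.
Proof. by have := LZ c (@cst_c 1); rewrite L_one mulr1. Qed.

Lemma functionalB (f g : X -> R) : continuous f -> continuous g ->
  L (fun y => f y - g y) = L f - L g.
Proof.
move=> fc gc; have -> : (fun y => f y - g y) = (fun y => f y + (-1) * g y).
  by apply/funext => y; rewrite mulN1r.
rewrite LD// ?LZ ?mulN1r//.
by apply: mul_c => //; exact: cst_c.
Qed.

Lemma le_functional (f g : X -> R) : continuous f -> continuous g ->
  (forall y, f y <= g y) -> L f <= L g.
Proof.
move=> fc gc fg; rewrite -subr_ge0 -functionalB//; apply: L_ge0; first exact: sub_c.
by move=> y; rewrite subr_ge0.
Qed.

Lemma continuous_fun_sum n (f : nat -> X -> R) : (forall k, continuous (f k)) ->
  continuous (fun y => \sum_(k < n) f k y).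
Proof.
move=> fc y.
apply: (@cvg_big _ _ +%R 0 xpredT _ _ _ _ (fun k : 'I_n => f k)) => [|k _].
  exact: add_continuous.
exact: fc.
Qed.

Lemma functional_sum n (f : nat -> X -> R) : (forall k, continuous (f k)) ->
  L (fun y => \sum_(k < n) f k y) = \sum_(k < n) L (f k).
Proof.
move=> fc; elim: n => [|n IH].
  rewrite big_ord0 -[RHS](functional_cst 0); congr L.
  by apply/funext => y; rewrite big_ord0.
rewrite big_ord_recr/= -IH -LD//; last exact: continuous_fun_sum.
by congr L; apply/funext => y; rewrite big_ord_recr.
Qed.

(* Increasing sequences are used instead of nonnegative series so that countable
   subadditivity needs no double series. *)
Definition covered (A : set X) (c : R) : Prop :=
  exists f : nat -> X -> R, [/\ forall k, continuous (f k),
    forall k y, 0 <= f k y,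
    forall y, {homo (fun k => f k y) : k l / (k <= l)%N >-> k <= l},
    forall y, A y -> forall e, 0 < e -> exists k, 1 - e <= f k y &
    forall k, L (f k) <= c].

Definition daniell_measure (A : set X) : \bar R :=
  ereal_inf [set c%:E | c in covered A].

Local Notation mu := daniell_measure.

Lemma covered_ge0 A c : covered A c -> 0 <= c.
Proof. by move=> [f [fc f0 _ _ /(_ 0%N)]]; apply: le_trans; exact: L_ge0. Qed.

Lemma sub_covered A B c c' : A `<=` B -> c <= c' -> covered B c -> covered A c'.
Proof.
move=> AB cc' [f [fc f0 f_incr fB fc_le]]; exists f; split => //.
  by move=> y /AB; exact: fB.
by move=> k; exact: le_trans (fc_le k) cc'.
Qed.

Lemma covered_cst A (f : X -> R) : continuous f -> (forall y, 0 <= f y) ->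
  (forall y, A y -> 1 <= f y) -> covered A (L f).
Proof.
move=> fc f0 fA; exists (fun=> f); split => //; first by move=> y k l _; exact: lexx.
by move=> y Ay e e0; exists 0%N; have := fA y Ay; lra.
Qed.

Lemma covered1 A : covered A 1.
Proof. by rewrite -L_one; apply: covered_cst. Qed.

Lemma daniell_measure_le A c : covered A c -> (mu A <= c%:E)%E.
Proof. by move=> Ac; apply: ereal_inf_lbound; exists c. Qed.

Lemma daniell_measure_lt A c : (mu A < c%:E)%E -> covered A c.
Proof.
move=> /ereal_inf_lt[_ [b Ab <-]]; rewrite lte_fin => bc.
exact: sub_covered (ltW bc) Ab.
Qed.

Lemma daniell_measure_ge0 A : (0 <= mu A)%E.
Proof.
by apply: le_ereal_inf_tmp => _ [c /covered_ge0 c0 <-]; rewrite lee_fin.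
Qed.

Lemma daniell_measure_le1 A : (mu A <= 1)%E.
Proof. exact: daniell_measure_le (covered1 A). Qed.

Lemma daniell_measure_fin A : mu A \is a fin_num.
Proof.
apply/fin_real/andP; split.
  by apply: lt_le_trans (daniell_measure_ge0 A); exact: ltNyr.
by apply: le_lt_trans (daniell_measure_le1 A) _; exact: ltry.
Qed.

Lemma le_daniell_measure : {homo mu : A B / A `<=` B >-> (A <= B)%E}.
Proof.
move=> A B AB; apply: ereal_inf_le_tmp => _ [c Bc <-]; exists c => //.
exact: sub_covered Bc.
Qed.

Lemma daniell_measure0 : mu set0 = 0%E.
Proof.
apply/eqP; rewrite eq_le daniell_measure_ge0 andbT.
by apply: daniell_measure_le; rewrite -(functional_cst 0); apply: covered_cst.
Qed.

Lemma daniell_measure_near A e : 0 < e -> covered A (fine (mu A) + e).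
Proof.
move=> e0; apply: daniell_measure_lt.
by rewrite EFinD fineK ?daniell_measure_fin// lteDl ?daniell_measure_fin// lte_fin.
Qed.

Lemma daniell_sigma_subadditive : sigma_subadditive mu.
Proof.
move=> A; apply/lee_addgt0Pr => e e0.
apply: le_trans (epsilon_trick _ _ (ltW e0)); last first.
  by move=> n; exact: daniell_measure_ge0.
set S := (X in (_ <= X)%E).
have S_ge n : ((\sum_(i < n) (fine (mu (A i)) + e / (2 ^ i.+1)%:R))%:E <= S)%E.
  rewrite -sumEFin /S.
  apply: le_trans (nneseries_lim_ge n _); last first.
    move=> i _ _; rewrite adde_ge0 ?daniell_measure_ge0// lee_fin.
    by rewrite divr_ge0// ltW.
  rewrite big_mkord; apply: lee_sum => i _.
  by rewrite EFinD fineK ?daniell_measure_fin.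
case SE : S => [s||]; [|exact: leey|by have := S_ge 0%N; rewrite SE big_ord0].
have /choice[f fP] : forall n, exists f : nat -> X -> R, [/\ forall k, continuous (f k),
    forall k y, 0 <= f k y,
    forall y, {homo (fun k => f k y) : k l / (k <= l)%N >-> k <= l},
    forall y, A n y -> forall e, 0 < e -> exists k, 1 - e <= f k y &
    forall k, L (f k) <= fine (mu (A n)) + e / (2 ^ n.+1)%:R].
  by move=> n; apply: daniell_measure_near; rewrite divr_gt0// ltr0n expn_gt0.
have fc n k : continuous (f n k) by have [] := fP n.
have f0 n k y : 0 <= f n k y by have [] := fP n.
(* Diagonal partial sums: the k-th function adds the k-th functions of the first k covers, whose
   errors e / 2 ^ n.+1 sum to at most e. *)
apply: daniell_measure_le; exists (fun k y => \sum_(n < k) f n k y); split.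
- by move=> k; apply: (@continuous_fun_sum k (fun n => f n k)) => n.
- by move=> k y; apply: sumr_ge0.
- move=> y k l kl; rewrite (le_trans (ler_sum _ (G := fun n : 'I_k => f n l y) _))//.
    by move=> n _; have [_ _ f_incr _ _] := fP n; exact: f_incr.
  rewrite -!(big_mkord xpredT (fun n => f n l y)).
  by rewrite (big_cat_nat (n := k) (p := l))//= lerDl sumr_ge0.
- move=> y [n _ Any] d d0; have [_ _ f_incr fA _] := fP n.
  have [k dk] := fA y Any d d0; exists (maxn n.+1 k).
  apply: (le_trans dk); apply: le_trans (f_incr y k (maxn n.+1 k) (leq_maxr _ _)) _.
  have nm : (n < maxn n.+1 k)%N by rewrite leq_max ltnSn.
  by rewrite (bigD1 (Ordinal nm))//= lerDl sumr_ge0.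
- move=> k; rewrite (@functional_sum _ (fun n => f n k))//.
  rewrite -lee_fin -SE (le_trans _ (S_ge k))// lee_fin; apply: ler_sum => n _.
  by have [_ _ _ _] := fP n; exact.
Qed.

(* Dini's argument. *)
Lemma covered_closed B c e : closed B -> covered B c -> 0 < e ->
  exists h : X -> R, [/\ continuous h, forall y, 0 <= h y, L h <= c &
    forall y, B y -> 1 - e <= h y].
Proof.
move=> clB [f [fc f0 f_incr fB f_le]] e0.
have /compact_near_coveringP/near_covering_withinP cptB : compact B.
  exact: subclosed_compact clB cptX (@subsetT _ B).
have [k _ Bk] : \forall k \near \oo, B `<=` (fun y => 1 - e <= f k y).
  apply: cptB => y By; have [k0 k0y] := fB y By _ (divr_gt0 e0 (ltr0Sn R 1)).
  have /cvgrPdist_lt/(_ _ (divr_gt0 e0 (ltr0Sn R 1))) near_y := fc k0 y.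
  exists ([set y' | `|f k0 y - f k0 y'| < e / 2], [set k | (k0 <= k)%N]).
    by split; [exact: near_y|exact: nbhs_infty_ge].
  move=> [y' k]/= [yy' k0k] _; have := f_incr y' _ _ k0k.
  by move: yy'; rewrite ltr_norml => /andP[]; lra.
by exists (f k); split => // y By; apply: Bk => /=.
Qed.

(** Compactness replaces a cover of the whole space by a single continuous function at least 1 - e,
    on which L is at least 1 - e. *)
Lemma daniell_measureT : mu setT = 1%E.
Proof.
apply/eqP; rewrite eq_le daniell_measure_le1/=.
apply: le_ereal_inf_tmp => _ [c covc <-]; rewrite lee_fin.
apply/ler_addgt0Pr => e e0.
have [h [hc h0 hc_le h1]] := covered_closed closedT covc e0.
rewrite -lerBlDr -(functional_cst (1 - e)) (le_trans _ hc_le)//.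
by apply: le_functional => // y; exact: h1.
Qed.

HB.instance Definition _ := isOuterMeasure.Build R X mu daniell_measure0
  daniell_measure_ge0 le_daniell_measure daniell_sigma_subadditive.

(* If g_n increases to the indicator of O and f_k covers A, then f_k g_k covers
   A `&` O and, for each fixed n, the f_k (1 - g_n) cover the rest of A. *)
Lemma open_caratheodory O : open O -> mu.-caratheodory O.
Proof.
move=> oO; apply: le_caratheodory_measurable => A.
apply: le_ereal_inf_tmp => _ [c [f [fc f0 f_incr fA f_le]] <-].
have [g [gc g01 g_incr g_out g_in]] := open_indicator_approx oO.
have g0 n y : 0 <= g n y by case/andP: (g01 n y).
have g1 n y : g n y <= 1 by case/andP: (g01 n y).
pose a := sup [set L (fun y => f k y * g k y) | k in [set: nat]].
have fg_le k n : L (fun y => f k y * g n y) <= c.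
  apply: le_trans (f_le k); apply: le_functional => //; first exact: mul_c.
  by move=> y; rewrite ler_piMr.
have fg_sup : has_sup [set L (fun y => f k y * g k y) | k in [set: nat]].
  by split; [exists (L (fun y => f 0%N y * g 0%N y)), 0%N|
    exists c => _ [k _ <-]; exact: fg_le].
apply/lee_addgt0Pr => e e0.
have AO : (mu (A `&` O) <= a%:E)%E.
  apply: daniell_measure_le; exists (fun k y => f k y * g k y); split.
  - by move=> k; exact: mul_c.
  - by move=> k y; rewrite mulr_ge0.
  - by move=> y k l kl; apply: ler_pM => //; [exact: f_incr|exact: g_incr].
  - move=> y [/fA Ay /g_in[n _ gn1]] d /Ay[k dk].
    exists (maxn k n); rewrite (gn1 (maxn k n)) ?mulr1 /= ?leq_maxr//.
    by apply: le_trans dk _; apply: f_incr; rewrite leq_maxl.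
  - by move=> k; apply: ub_le_sup; [case: fg_sup|exists k].
(* Freezing g at this n costs at most e: L (f_k g_n) >= L (f_n g_n) > a - e for k >= n, so L (f_k (1
   - g_n)) <= c - a + e. *)
have [_ [n _ <-] an] := sup_adherent e0 fg_sup.
have AnO : (mu (A `&` ~` O) <= (c - a + e)%:E)%E.
  apply: daniell_measure_le; exists (fun k y => f (k + n)%N y * (1 - g n y)); split.
  - by move=> k; apply: mul_c => //; apply: sub_c.
  - by move=> k y; rewrite mulr_ge0// subr_ge0.
  - move=> y k l kl; rewrite ler_wpM2r ?subr_ge0//.
    by apply: f_incr; rewrite leq_add2r.
  - move=> y [/fA Ay /= nOy] d /Ay[k dk]; exists k.
    rewrite g_out// subr0 mulr1; apply: le_trans dk _.
    by apply: f_incr; rewrite leq_addr.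
  - move=> k; have -> : (fun y => f (k + n)%N y * (1 - g n y)) =
        (fun y => f (k + n)%N y - f (k + n)%N y * g n y).
      by apply/funext => y; rewrite mulrBr mulr1.
    rewrite functionalB//; last exact: mul_c.
    have : L (fun y => f n y * g n y) <= L (fun y => f (k + n)%N y * g n y).
      apply: le_functional; try exact: mul_c.
      by move=> y; rewrite ler_wpM2r//; apply: f_incr; rewrite leq_addl.
    by have := f_le (k + n)%N; move: an; rewrite -/a; lra.
apply: le_trans (leeD AO AnO) _.
by rewrite -!EFinD lee_fin; lra.
Qed.

Let nu (A : set (borel x0)) : \bar R := mu A.

Lemma borel_caratheodory (A : set (borel x0)) :
  measurable A -> mu.-caratheodory (A : set X).
Proof.
apply: smallest_sub; last by move=> O; exact: open_caratheodory.
split; first exact: caratheodory_measurable_set0.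
  by move=> B mB; rewrite setTD; exact: caratheodory_measurable_setC.
by move=> B mB; exact: caratheodory_measurable_bigcup.
Qed.

Let nu_sigma_additive : semi_sigma_additive nu.
Proof.
move=> A mA tA mUA.
apply: (@caratheodory_measure_sigma_additive R (pointed_at x0) mu A) => //.
  by move=> n; exact: borel_caratheodory.
exact: borel_caratheodory.
Qed.

HB.instance Definition _ := isMeasure.Build _ _ _ nu daniell_measure0
  daniell_measure_ge0 nu_sigma_additive.

HB.instance Definition _ := Measure_isProbability.Build _ _ _ nu daniell_measureT.

Lemma daniell_probability : exists P : probability (borel x0) R,
  forall A : set X, P A = mu A.
Proof. by exists nu. Qed.

Variable P : probability (borel x0) R.
Hypothesis PE : forall A : set X, P A = mu A.

Let PT : (P : {measure set _ -> \bar R}) setT = 1%E.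
Proof. exact: probability_setT. Qed.

(* Slicing n f into unit layers: n f <= 1 + \sum_j \1_(j + 1 <= n f), while the
   clamped layers dominating these indicators sum to n f. *)
Lemma le_daniell_integral (f : X -> R) : continuous f -> (forall y, 0 <= f y) ->
  \int[P]_(y in setT) (f y : R) <= L f.
Proof.
move=> fc f0; have [M M0 fM] := compact_continuous_bounded cptX fc.
have fint := bounded_continuous_integrable P fc fM.
set I := \int[P]_(y in setT) (f y : R).
(* The slicing error 1 does not depend on n, so dividing by n and letting n grow removes it. *)
suff nI n : n%:R * I <= 1 + n%:R * L f.
  rewrite leNgt; apply/negP => LI.
  have [n /=] : exists n, ((I - L f)^-1 < n%:R) .
    by exists (Num.truncn (I - L f)^-1).+1; exact: truncnS_gt.
  by have := nI n; rewrite -div1r ltr_pdivrMr ?subr_gt0//; lra.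
pose A j : set (borel x0) := [set y | j.+1%:R <= n%:R * f y].
have nfc : continuous (fun y => n%:R * f y) by exact: mul_c.
have mA j : measurable (A j).
  apply: closed_borel; rewrite (_ : A j = (fun y => n%:R * f y) @^-1` [set t | j.+1%:R <= t])//.
  apply: closed_comp; last exact: closed_ge.
  by move=> y _; exact: nfc.
have PA j : (P (A j) <= (L (fun y => clamp (n%:R * f y - j%:R)))%:E)%E.
  rewrite PE; apply: daniell_measure_le; apply: covered_cst.
  - by apply: continuous_fun_min => //; apply: continuous_fun_max => //; exact: sub_c.
  - by move=> y; exact: clamp_ge0.
  - by move=> y; rewrite /A /= -natr1 => ?; rewrite clamp_eq1//; lra.
have nfM y : n%:R * f y <= (n * M)%:R.
  by rewrite natrM ler_wpM2l// (le_trans (ler_norm _)).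
have point y : n%:R * f y <= 1 + \sum_(j < n * M) \1_(A j) y.
  have := sum_clamp (n%:R * f y - 1) (n * M).
  set m := Num.min _ _ => clampE.
  have : n%:R * f y - 1 <= m.
    by rewrite le_min le_max lexx/=; have := nfM y; lra.
  rewrite -clampE lerBlDl => /le_trans; apply; rewrite lerD2l.
  apply: ler_sum => j _; apply: le_trans (clamp_le_indic _) _.
  rewrite indicE ler_nat; case: ltP => // tj; rewrite mem_set//= /A/=.
  by rewrite -natr1; lra.
have : (\int[P]_y (n%:R * f y)%:E <=
    \int[P]_y (1 + \sum_(j < n * M) (\1_(A j) y)%:E))%E.
  apply: ge0_le_integral => //.
  - by move=> y _; rewrite lee_fin mulr_ge0.
  - by apply/measurable_EFinP; exact: continuous_borel_measurable.
  - apply: emeasurable_funD => //; apply: emeasurable_sum => j.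
    by apply/measurable_EFinP; exact: measurable_indic.
  - by move=> y _; rewrite sumEFin -EFinD lee_fin.
have -> : (\int[P]_y (n%:R * f y)%:E = (n%:R * I)%:E)%E.
  under eq_integral do rewrite EFinM.
  rewrite ge0_integralZl//=; last 2 first.
    by apply/measurable_EFinP; exact: continuous_borel_measurable.
    by move=> y _; rewrite lee_fin.
  by rewrite EFinM /I /Rintegral fineK//; exact: integrable_fin_num.
rewrite ge0_integralD//; last 2 first.
  by move=> y _; apply: sume_ge0 => j _; rewrite lee_fin.
  apply: emeasurable_sum => j.
  by apply/measurable_EFinP; exact: measurable_indic.
rewrite integral_cst// PT mule1 ge0_integral_sum//; last first.
  by move=> j; apply/measurable_EFinP; exact: measurable_indic.
under eq_bigr do rewrite integral_indic// setIT.
move=> nI_le; rewrite -lee_fin (le_trans nI_le)// EFinD leeD2l//.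
apply: (@le_trans _ _ (\sum_(j < n * M)
    (L (fun y => clamp (n%:R * f y - j%:R)))%:E)%E).
  by apply: lee_sum => j _; exact: PA.
rewrite sumEFin lee_fin -LZ// -(@functional_sum _ (fun j y => clamp (n%:R * f y - j%:R))).
  rewrite le_eqVlt; apply/orP; left; apply/eqP; congr L; apply/funext => y.
  by rewrite sum_clamp max_l ?mulr_ge0// min_l.
by move=> j; apply: continuous_fun_min => //; apply: continuous_fun_max => //; exact: sub_c.
Qed.

(** The one-sided bound for nonnegative functions, applied to f + M and to M - f, gives both
    inequalities. *)
Lemma daniell_integral (f : X -> R) : continuous f ->
  \int[P]_(y in setT) (f y : R) = L f.
Proof.
move=> fc; have [M M0 fM] := compact_continuous_bounded cptX fc.
have fint := bounded_continuous_integrable P fc fM.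
have Mint : P.-integrable setT (EFin \o (fun=> M%:R : R)).
  exact: (@bounded_continuous_integrable _ _ x0 P (fun=> M%:R) `|M%:R|).
have intM : \int[P]_(y in setT) (M%:R : R) = M%:R.
  by rewrite Rintegral_cst// PT mulr1.
have fM' y : - M%:R <= f y <= M%:R by rewrite -ler_norml.
apply/eqP; rewrite eq_le; apply/andP; split.
  have := @le_daniell_integral (fun y => f y + M%:R).
  rewrite RintegralD// intM LD// functional_cst lerD2r; apply.
    exact: add_c.
  by move=> y; have /andP[] := fM' y; lra.
have := @le_daniell_integral (fun y => M%:R - f y).
rewrite RintegralB// intM functionalB// functional_cst lerD2l lerN2; apply.
  exact: sub_c.
by move=> y; have /andP[] := fM' y; lra.
Qed.

(** Covers pull back along T without changing L, so preimages never have larger mass; applying this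
    to the complement of A gives equality. *)
Lemma daniell_invariant (T : X -> X) (A : set (borel x0)) : continuous T ->
  (forall f : X -> R, continuous f -> L (f \o T) = L f) ->
  measurable A -> P (T @^-1` A) = P A.
Proof.
move=> Tc LT mA.
have le_preimage (B : set X) : (P (T @^-1` B) <= P B)%E.
  rewrite !PE; apply: le_ereal_inf_tmp => _ [c [f [fc f0 f_incr fB f_le]] <-].
  apply: daniell_measure_le; exists (fun k => f k \o T); split.
  - by move=> k y; apply: continuous_comp; [exact: Tc|exact: fc].
  - by move=> k y /=.
  - by move=> y k l kl; exact: f_incr.
  - by move=> y By e e0; exact: fB.
  - by move=> k; rewrite LT.
have mTA : measurable (T @^-1` A : set (borel x0)).
  by rewrite -[X in measurable X]setTI; exact: continuous_borel_map.
apply/eqP; rewrite eq_le le_preimage/=.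
have := le_preimage (~` A); rewrite preimage_setC !probability_setC//.
have : P A \is a fin_num by exact: fin_num_measure.
have : P (T @^-1` A) \is a fin_num by exact: fin_num_measure.
case: (P A) (P _) => [a||] [b||]//= _ _.
by rewrite -!EFinB !lee_fin lerD2l lerN2.
Qed.

End daniell.

(** * From Chowla's condition to systems of zero topological entropy *)

Section Ch_S0_strong.
Context {R : realType}.

Lemma expRN_small (c e : R) : 0 < c -> 0 < e ->
  \forall m \near \oo, expR (- (c * m%:R)) <= e.
Proof.
move=> c0 e0; near=> m.
have m_ge : (c * e)^-1 <= m%:R by near: m; exact: nbhs_infty_ger.
have cm : e^-1 <= c * m%:R by rewrite -ler_pdivrMl// -invfM.
rewrite expRN -[leRHS]invrK lef_pV2 ?posrE ?expR_gt0 ?invr_gt0//.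
by rewrite (le_trans _ (expR_ge1Dx _))// (le_trans cm)// lerDr.
Unshelve. all: end_near. Qed.

Lemma orthogonal_to_le1 (z : int -> R) (X : metricType R) (T : X -> X) (x : X) :
  compact [set: X] ->
  (forall f : X -> R, continuous f -> (forall y, `|f y| <= 1) ->
    orthogonal_to z T f x) ->
  forall f : X -> R, continuous f -> orthogonal_to z T f x.
Proof.
move=> cptX orth1 f fc r a i0 i adm.
have [m m0 fm] := compact_continuous_bounded cptX fc.
pose M : R := m%:R; have M0 : 0 < M by rewrite ltr0n.
have fM y : `|f y| <= M by exact: fm.
have := orth1 (fun y => M^-1 * f y).
have scaled_c : continuous (fun y => M^-1 * f y).
  by move=> y; apply: cvgM; [exact: cvg_cst|exact: fc].
have scaled_le1 y : `|M^-1 * f y| <= 1.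
  by rewrite normrM gtr0_norm ?invr_gt0// mulrC ler_pdivrMr// mul1r.
move=> /(_ scaled_c scaled_le1 r a i0 i adm) limf.
apply: cvg_to_eq (mulr0 M); apply: cvg_trans (cvgM (cvg_cst M) limf).
apply: near_eq_cvg; apply: nearW => N /=.
rewrite mulrCA mulr_sumr; congr (_ * _); apply: eq_bigr => n _.
by rewrite !mulrA divff ?mul1r// gt_eqF.
Qed.

Theorem Ch_S0_strong (z : int -> R) :
  (forall n : nat, (0 < n)%N -> z n \in [:: -1; 0; 1]) ->
  Ch z -> S0_strong z.
Proof.
move=> z_sign chz X T cptX _ h0 f fc x; move: f fc.
apply: orthogonal_to_le1 => // f fc f1 r a i0 i adm.
apply: (@cvg_average_mul _ \oo (correlation z a i0 i) (fun n => f (iter n T x))) => //.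
- by move=> n n0; exact: norm_correlation_le1.
- by move=> m S S0; exact: Ch_product.
move=> e e0 e1; have [d d0 fd] := compact_unif_continuous cptX fc e0.
(* Half of the deviation rate e^2 / 8: the number of words times the deviation bound is then at most
   exp(- c m). *)
pose c := e ^+ 2 / 16; have c0 : 0 < c by rewrite divr_gt0 ?exprn_gt0.
have [m [[m0 sep_m] small_m]] : exists m : nat, ((0 < m)%N /\
    (max_separated T m d <= (expR (c * m%:R))%:E)%E) /\ expR (- (c * m%:R)) <= e.
  apply: (@filter_ex _ \oo); apply: filterI; last exact: expRN_small.
  by apply: filterI; [exact: nbhs_infty_gt|exact: max_separated_subexp].
have [E Ec span] := max_separated_spanning d0 sep_m.
exists m, #|` E|, (fun j h => f (iter h T (nth x E j))); split => //.
  rewrite (le_trans _ small_m)//.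
  have -> : - (c * m%:R) = c * m%:R + - (e ^+ 2 * m%:R / 8) by rewrite /c; lra.
  by rewrite expRD ler_pM2r ?expR_gt0.
(* Every orbit segment is shadowed by a point of E, so no positive n is far from the words. *)
apply: nearW => N; rewrite (@eq_average _ _ (fun=> 0)) => [|n _].
  by rewrite /average big1// mulr0 ltW.
rewrite indicE memNset// => /= far.
have [y yE close] := span (iter n T x).
have yj : (index y E < #|` E|)%N by rewrite index_mem.
have [h hm] := far (Ordinal yj).
rewrite /= nth_index// ltNge => /negP; apply.
by rewrite distrC addnC iterD; apply: fd; exact: close.
Qed.

End Ch_S0_strong.

(** * Words of zero entropy *)

Section fekete.
Context {R : realType} (a : nat -> R).

(** Fekete's lemma: the limit is the infimum of a n / n over n >= 1, by dividing n by a nearly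
    optimal length. The indexing by n.+1 keeps out n = 0, where the quotient would be 0 by
    convention. *)
Lemma subadditive_cvg : (forall n, 0 <= a n) ->
  (forall m n, a (m + n)%N <= a m + a n) -> cvg (n%:R^-1 * a n @[n --> \oo]).
Proof.
move=> a0 a_sub; pose S := [set n.+1%:R^-1 * a n.+1 | n in [set: nat]].
have S_inf : has_inf S.
  by split; [exists (1%:R^-1 * a 1%N), 0%N|
    exists 0 => _ [n _ <-]; rewrite mulr_ge0].
apply/cvg_ex; exists (inf S); apply/cvgrPdist_le => e e0.
have [_ [n0 _ <-] an0] := inf_adherent (divr_gt0 e0 (ltr0Sn R 1)) S_inf.
pose C := \sum_(r < n0.+1) a r.
have a_mul q r : a (q * n0.+1 + r)%N <= q%:R * a n0.+1 + a r.
  elim: q => [|q IH]; first by rewrite mul0n add0n mul0r add0r.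
  by rewrite mulSn -addnA (le_trans (a_sub _ _))// -natr1; lra.
near=> n; have n_gt0 : (0 < n)%N by near: n; exact: nbhs_infty_gt.
have nR : 0 < n%:R :> R by rewrite ltr0n.
have Cn : 2 * C / e <= n%:R by near: n; exact: nbhs_infty_ger.
have : inf S <= n%:R^-1 * a n.
  apply: ge_inf; first by case: S_inf.
  by exists n.-1; rewrite ?prednK.
have : n%:R^-1 * a n <= inf S + e.
  rewrite ler_pdivrMl// (divn_eq n n0.+1) (le_trans (a_mul _ _))// -divn_eq.
  have rC : a (n %% n0.+1)%N <= C.
    have rn0 : (n %% n0.+1 < n0.+1)%N by rewrite ltn_mod.
    by rewrite /C (bigD1 (Ordinal rn0))//= lerDl sumr_ge0.
  have qn : (n %/ n0.+1)%:R * n0.+1%:R <= n%:R :> R by rewrite -natrM ler_nat leq_trunc_div.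
  have an : a n0.+1 <= (inf S + e / 2) * n0.+1%:R.
    by rewrite -ler_pdivrMr// mulrC ltW.
  have infS0 : 0 <= inf S + e / 2.
    by rewrite (le_trans _ (ltW an0))// mulr_ge0.
  have : (n %/ n0.+1)%:R * a n0.+1 <= (inf S + e / 2) * n%:R.
    apply: le_trans (ler_wpM2l _ an) _ => //.
    by rewrite mulrCA ler_wpM2l.
  by move: Cn; rewrite ler_pdivrMr// => Cn; lra.
by rewrite ler_norml => ? ?; lra.
Unshelve. all: end_near. Qed.

End fekete.

Section finite_entropy.
Context {R : realType}.

Lemma entropy_subadditive (A B : finType) (q : A -> B -> R)
    (qA : A -> R) (qB : B -> R) :
  (forall a b, 0 <= q a b) -> \sum_a \sum_b q a b = 1 ->
  (forall a, qA a = \sum_b q a b) -> (forall b, qB b = \sum_a q a b) ->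
  - (\sum_a \sum_b q a b * ln (q a b)) <=
  - (\sum_a qA a * ln (qA a)) - (\sum_b qB b * ln (qB b)).
Proof.
move=> q0 q1 qAE qBE.
have qA_ge a b : q a b <= qA a by rewrite qAE (bigD1 b)//= lerDl sumr_ge0.
have qB_ge a b : q a b <= qB b by rewrite qBE (bigD1 a)//= lerDl sumr_ge0.
(* [ln t <= t - 1] at [t = qA a * qB b / q a b]. *)
have gibbs a b : q a b * ln (qA a) + q a b * ln (qB b) - q a b * ln (q a b) <=
    qA a * qB b - q a b.
  have := q0 a b; rewrite le_eqVlt => /orP[/eqP<-|q_gt0].
    by rewrite !mul0r !addr0 !subr0 mulr_ge0// ?qAE ?qBE sumr_ge0.
  have qA0 := lt_le_trans q_gt0 (qA_ge a b).
  have qB0 := lt_le_trans q_gt0 (qB_ge a b).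
  rewrite -mulrDr -mulrBr -lnM// -ln_div ?posrE ?mulr_gt0//.
  have -> : qA a * qB b - q a b = q a b * (qA a * qB b / q a b - 1).
    by rewrite mulrBr mulr1 mulrCA divff ?mulr1// gt_eqF.
  rewrite ler_pM2l//.
  have := @le_ln1Dx R (qA a * qB b / q a b - 1).
  by rewrite [1 + _]addrC subrK; apply; rewrite ltrBrDl subrr divr_gt0// mulr_gt0.
have sumA : \sum_a \sum_b q a b * ln (qA a) = \sum_a qA a * ln (qA a).
  by apply: eq_bigr => a _; rewrite qAE mulr_suml.
have sumB : \sum_a \sum_b q a b * ln (qB b) = \sum_b qB b * ln (qB b).
  by rewrite exchange_big/=; apply: eq_bigr => b _; rewrite qBE mulr_suml.
have sumAB : \sum_a \sum_b qA a * qB b = 1.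
  under eq_bigr do rewrite -mulr_sumr.
  rewrite -mulr_suml (eq_bigr _ (fun a _ => qAE a)) (eq_bigr _ (fun b _ => qBE b)).
  by rewrite q1 mul1r exchange_big.
have : \sum_a \sum_b (q a b * ln (qA a) + q a b * ln (qB b) - q a b * ln (q a b))
    <= \sum_a \sum_b (qA a * qB b - q a b).
  by apply: ler_sum => a _; apply: ler_sum => b _; exact: gibbs.
under eq_bigr do rewrite sumrB big_split/=.
under [X in _ <= X]eq_bigr do rewrite sumrB.
by rewrite !sumrB big_split/= sumA sumB sumAB q1; lra.
Qed.

End finite_entropy.

Section zero_entropy_words.
Context {R : realType} {d : measure_display} {Y : measurableType d}.
Variables (T : Y -> Y) (nu : probability Y R).
Hypothesis mT : measurable_fun setT T.
Hypothesis nuT : forall A, measurable A -> nu (T @^-1` A) = nu A.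
Variables (k : nat) (P : 'I_k -> set Y).
Hypothesis partP : measurable_partition P.

Let cell n (w : {ffun 'I_n -> 'I_k}) : set Y := join_cell T P w.
Let p n (w : {ffun 'I_n -> 'I_k}) : R := fine (nu (cell w)).

Let measurable_iter n A : measurable A -> measurable (iter n T @^-1` A).
Proof.
move=> mA; elim: n => [//|n IH].
rewrite (_ : iter n.+1 T @^-1` A = T @^-1` (iter n T @^-1` A)).
  by rewrite -[X in measurable X]setTI; exact: mT.
by apply/seteqP; split=> y; rewrite /preimage/= -iterSr.
Qed.

Let nu_iter n A : measurable A -> nu (iter n T @^-1` A) = nu A.
Proof.
move=> mA; elim: n => [//|n IH].
rewrite (_ : iter n.+1 T @^-1` A = T @^-1` (iter n T @^-1` A)).
  by rewrite nuT ?IH//; exact: measurable_iter.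
by apply/seteqP; split=> y; rewrite /preimage/= -iterSr.
Qed.

Lemma measurable_join_cell n (w : {ffun 'I_n -> 'I_k}) : measurable (cell w).
Proof.
apply: fin_bigcap_measurable; first exact: finite_finset.
by move=> i _; apply: measurable_iter; have [+ _ _] := partP; exact.
Qed.

Lemma join_cell_word n y : exists w : {ffun 'I_n -> 'I_k}, cell w y.
Proof.
have word i : exists j, P j (iter i T y).
  by have [_ _ /seteqP[_ /(_ (iter i T y) I)[j _ Pj]]] := partP; exists j.
exists [ffun i : 'I_n => sval (cid (word i))] => i _ /=.
by rewrite ffunE; case: cid.
Qed.

Let cell_eq n (w w' : {ffun 'I_n -> 'I_k}) y : cell w y -> cell w' y -> w = w'.
Proof.
move=> wy w'y; apply/ffunP => i; have [_ /trivIsetP tP _] := partP.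
apply: contrapT => /eqP ww'.
have : (P (w i) `&` P (w' i)) (iter i T y) by split; [exact: wy|exact: w'y].
by rewrite tP.
Qed.

Let nu_fin A : measurable A -> nu A \is a fin_num.
Proof. exact: fin_num_measure. Qed.

(** Cells of different itineraries are disjoint. The shift m and the set A are free so that both
    marginals of the law of two consecutive words can be computed. *)
Lemma measure_words_in m n (A : set Y) (G : {set {ffun 'I_n -> 'I_k}}) :
  measurable A ->
  fine (nu (A `&` \bigcup_(w in [set` G]) (iter m T @^-1` cell w))) =
  \sum_(w in G) fine (nu (A `&` (iter m T @^-1` cell w))).
Proof.
move=> mA; have mAw (w : {ffun 'I_n -> 'I_k}) :
    measurable (A `&` (iter m T @^-1` cell w)).
  by apply: measurableI => //; apply: measurable_iter; exact: measurable_join_cell.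
rewrite setI_bigcupr measure_fin_bigcup//.
- rewrite (fsbigE (enum G)) ?enum_uniq//=.
  + rewrite -sum_fine; last by move=> w _; exact: nu_fin.
    by rewrite big_enum_cond/=; apply: eq_bigl => w; rewrite mem_setE andbb.
  + by move=> w /=; rewrite mem_enum.
  + by move=> w /= wG; rewrite mem_enum wG.
- apply/trivIsetP => w w' _ _ ww'; rewrite -subset0 => y [[_ wy] [_ w'y]].
  by move: ww'; rewrite (cell_eq wy w'y) eqxx.
Qed.

Lemma measure_words m n (A : set Y) : measurable A ->
  fine (nu A) =
  \sum_(w : {ffun 'I_n -> 'I_k}) fine (nu (A `&` (iter m T @^-1` cell w))).
Proof.
move=> mA; have := measure_words_in m [set: {ffun 'I_n -> 'I_k}]%SET mA.
rewrite (_ : \bigcup_(w in _) _ = setT) ?setIT => [->|].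
  by apply: eq_bigl => w; rewrite inE.
rewrite -subTset => y _; have [w wy] := join_cell_word n (iter m T y).
by exists w => //=; rewrite inE.
Qed.

Let p_ge0 n (w : {ffun 'I_n -> 'I_k}) : 0 <= p w.
Proof. exact/fine_ge0/measure_ge0. Qed.

Let sum_p n : \sum_(w : {ffun 'I_n -> 'I_k}) p w = 1.
Proof.
have := @measure_words 0 n setT measurableT; rewrite probability_setT /= => ->.
by apply: eq_bigr => w _; rewrite setTI.
Qed.

Let cat_word m n (u : {ffun 'I_m -> 'I_k}) (v : {ffun 'I_n -> 'I_k}) :
  {ffun 'I_(m + n) -> 'I_k} :=
  [ffun i => match fintype.split i with inl a => u a | inr b => v b end].

Let cell_cat m n (u : {ffun 'I_m -> 'I_k}) (v : {ffun 'I_n -> 'I_k}) :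
  cell (cat_word u v) = cell u `&` (iter m T @^-1` cell v).
Proof.
apply/seteqP; split => [y uvy|y [uy vy] i _] /=.
  split=> [a _|b _] /=.
    by have := uvy (unsplit (inl a)) I; rewrite /cat_word ffunE unsplitK.
  by have := uvy (unsplit (inr b)) I; rewrite /cat_word ffunE unsplitK /= addnC iterD.
rewrite ffunE -{2}(splitK i); case: (fintype.split i) => [a|b] /=; first exact: uy.
by rewrite addnC iterD; exact: vy.
Qed.

Let sum_cat m n (F : {ffun 'I_(m + n) -> 'I_k} -> R) :
  \sum_w F w = \sum_u \sum_v F (cat_word u v).
Proof.
rewrite pair_big/= (reindex (fun uv => cat_word uv.1 uv.2))//=.
exists (fun w => ([ffun a => w (lshift n a)], [ffun b => w (rshift m b)])).
  move=> [u v] _ /=; congr pair; apply/ffunP => i; rewrite !ffunE.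
    by rewrite -[lshift n i]/(unsplit (inl i)) unsplitK.
  by rewrite -[rshift m i]/(unsplit (inr i)) unsplitK.
move=> w _ /=; apply/ffunP => i; rewrite ffunE -{2}(splitK i).
by case: (fintype.split i) => a /=; rewrite ffunE.
Qed.

(** A word of length m + n is a pair of consecutive words, and by invariance of nu the second has
    the law of an initial word of length n. *)
Lemma join_entropy_subadditive m n :
  join_entropy T nu P (m + n) <= join_entropy T nu P m + join_entropy T nu P n.
Proof.
rewrite /join_entropy sum_cat.
apply: (entropy_subadditive (q := fun u v => p (cat_word u v))) => //.
- by rewrite -(sum_cat (@p (m + n))) sum_p.
- move=> u; rewrite (measure_words m n) //; last exact: measurable_join_cell.
  by apply: eq_bigr => v _; rewrite /p cell_cat.
- move=> v; rewrite -(nu_iter m); last exact: measurable_join_cell.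
  rewrite (measure_words 0 m); last by apply: measurable_iter; exact: measurable_join_cell.
  by apply: eq_bigr => u _; rewrite /p cell_cat setIC.
Qed.

Let p_le1 n (w : {ffun 'I_n -> 'I_k}) : p w <= 1.
Proof. by rewrite -(sum_p n) (bigD1 w)//= lerDl sumr_ge0. Qed.

Let plnp_ge0 n (w : {ffun 'I_n -> 'I_k}) : 0 <= - (p w * ln (p w)).
Proof. by rewrite -mulrN mulr_ge0// oppr_ge0 ln_le0// p_le1. Qed.

Lemma join_entropy_ge0 n : 0 <= join_entropy T nu P n.
Proof. by rewrite /join_entropy -sumrN; apply: sumr_ge0 => w _; exact: plnp_ge0. Qed.

(** Fekete's lemma makes the [limn] in [partition_entropy] a genuine limit, and this limit is at
    most the entropy 0. *)
Lemma join_entropy_sublinear (eta : R) : ks_entropy T nu = 0%E -> 0 < eta ->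
  \forall n \near \oo, join_entropy T nu P n <= eta * n%:R.
Proof.
move=> h0 eta0.
have /cvgrPdist_le/(_ _ eta0) := subadditive_cvg join_entropy_ge0 join_entropy_subadditive.
have lim_le0 : partition_entropy T nu P <= 0.
  have : ((partition_entropy T nu P)%:E <= ks_entropy T nu)%E.
    by apply: ereal_sup_ubound; exists k, P.
  by rewrite h0 lee_fin.
apply: filterS2 (nbhs_infty_gt 0%N) => n n0; rewrite ler_norml => /andP[+ _].
rewrite -/(partition_entropy _ _ _) mulrC -ler_pdivrMr ?ltr0n// mulrC.
by move: lim_le0; lra.
Qed.

(** G collects the words of probability at least exp(- kappa n); since probabilities sum to 1, there
    are at most exp(kappa n) of them. Each other word contributes at least kappa n times its
    probability to the entropy, so together they have mass at most eta / kappa. *)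
Lemma few_words (n : nat) (kappa eta : R) : (0 < n)%N -> 0 < kappa ->
  join_entropy T nu P n <= eta * n%:R ->
  exists2 G : {set {ffun 'I_n -> 'I_k}}, #|G|%:R <= expR (kappa * n%:R) &
    (nu (~` \bigcup_(w in [set` G]) cell w) <= (eta / kappa)%:E)%E.
Proof.
move=> n0 kappa0 Hn; have nR : 0 < n%:R :> R by rewrite ltr0n.
pose G := [set w : {ffun 'I_n -> 'I_k} | expR (- (kappa * n%:R)) <= p w]%SET.
exists G.
  rewrite -[leRHS]mul1r -ler_pdivrMr ?expR_gt0// -expRN -[leRHS](sum_p n).
  rewrite [leRHS](bigID (mem G))/= -[leLHS]addr0 lerD ?sumr_ge0//.
  rewrite mulr_natl -sumr_const; apply: ler_sum => w.
  by rewrite inE.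
have mU : measurable (\bigcup_(w in [set` G]) cell w).
  apply: fin_bigcup_measurable; first exact: finite_finset.
  by move=> w _; exact: measurable_join_cell.
have -> : ~` (\bigcup_(w in [set` G]) cell w) =
    setT `&` \bigcup_(w in [set` (~: G)%SET]) (iter 0 T @^-1` cell w).
  rewrite setTI; apply/seteqP; split => [y yG|y [w /= wG wy] [w' /= w'G w'y]].
    have [w wy] := join_cell_word n y; exists w => //=.
    by rewrite finset.in_setC; apply/negP => wG; apply: yG; exists w.
  by move: wG; rewrite finset.in_setC -(cell_eq w'y wy) w'G.
set B := (X in nu X); have mB : measurable B.
  rewrite /B setTI; apply: fin_bigcup_measurable; first exact: finite_finset.
  by move=> w _; exact: measurable_join_cell.
rewrite -(fineK (nu_fin mB)) lee_fin /B measure_words_in//.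
under eq_bigr do rewrite setTI.
rewrite ler_pdivlMr// -(ler_pM2r nR) -mulrA (le_trans _ Hn)//.
rewrite /join_entropy -sumrN [leRHS](bigID (mem (~: G)%SET))/=.
rewrite -[leLHS]addr0 lerD//; last by apply: sumr_ge0 => w _; exact: plnp_ge0.
rewrite mulr_suml; apply: ler_sum => w; rewrite finset.in_setC inE -ltNge => pw.
(* Null words are treated apart, since ln 0 = 0 breaks the comparison of logarithms. *)
have := p_ge0 w; rewrite le_eqVlt => /orP[/eqP pw0|pw0].
  by rewrite -/(cell w) -/(p w) -pw0 !mul0r oppr0.
rewrite -mulrN ler_pM2l// lerNr -ler_expR lnK ?posrE//.
exact: ltW.
Qed.

End zero_entropy_words.

(** * Ultrafilter limits of empirical measures *)

Section ultrafilter_limits.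
Context {R : realType}.

Lemma ultra_bounded_cvg (T : Type) (U : set_system T) (u : T -> R) (M : R) :
  UltraFilter U -> (forall t, `|u t| <= M) -> cvg (u t @[t --> U]).
Proof.
move=> UU uM; apply/cvg_ex.
have UM : U (u @^-1` [set` `[- M, M]]).
  by apply: filterE => t; rewrite /= in_itv/= -ler_norml.
have [l [_ ul]] := @segment_compact R (- M) M (u @ U) _ UM.
exists l => V lV; have [//|UVC] := in_ultra_setVsetC (u @^-1` V) UU.
have : (u @ U) (~` V) by exact: UVC.
by move=> /ul/(_ lV)[y [? ?]].
Qed.

Lemma frequently_ultra (P : set nat) : ~ (\forall n \near \oo, ~ P n) ->
  exists U, [/\ UltraFilter U, U P & U --> \oo].
Proof.
move=> freqP; have PF : ProperFilter (within P \oo).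
  apply: Build_ProperFilter_ex => A PA; apply: contrapT => noA; apply: freqP.
  have PA' : \forall n \near \oo, P n -> A n by exact: PA.
  by near=> n => Pn; apply: noA; exists n; move: Pn; near: n.
have [U [UU PU]] := ultraFilterLemma PF; exists U; split => //.
  by apply: PU; apply: nearW.
move=> A ooA; apply: PU; rewrite /within/=.
by apply: filterS ooA.
Unshelve. all: end_near. Qed.

End ultrafilter_limits.

Section empirical_average.
Context {R : realType} {X : metricType R} (T : X -> X) (x : X).

(** The index m stands for N = m.+1, as in [empirical]. *)
Definition orbit_average (f : X -> R) (m : nat) : R :=
  average (fun n => f (iter n T x)) m.+1.

Lemma le_orbit_average f g m : (forall y, f y <= g y) ->
  orbit_average f m <= orbit_average g m.
Proof. by move=> fg; apply: ler_average. Qed.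

Lemma orbit_averageD f g m :
  orbit_average (fun y => f y + g y) m = orbit_average f m + orbit_average g m.
Proof. exact: averageD. Qed.

Lemma orbit_averageZ c f m :
  orbit_average (fun y => c * f y) m = c * orbit_average f m.
Proof. exact: averageZ. Qed.

Lemma orbit_average_cst c m : orbit_average (fun=> c) m = c.
Proof. exact: average_cst. Qed.

Lemma norm_orbit_average f M m : (forall y, `|f y| <= M) ->
  `|orbit_average f m| <= M.
Proof.
move=> fM; apply: le_trans (ler_norm_average _ _) _.
by rewrite -[leRHS](orbit_average_cst M m); exact: ler_average.
Qed.

Lemma orbit_average_invariant f M : (forall y, `|f y| <= M) ->
  orbit_average f m - orbit_average (f \o T) m @[m --> \oo] --> (0 : R).
Proof.
move=> fM; have := @average_shift _ (fun n => f (iter n T x)) M 1 (fun n _ => fM _).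
rewrite -cvg_shiftS; apply: cvg_trans; apply: near_eq_cvg; apply: nearW => m /=.
by congr (_ - average _ _); apply/funext => n; rewrite addn1.
Qed.

Lemma Rintegral_empirical (f : X -> R) (M : R) m : continuous f -> (forall y, `|f y| <= M) ->
  \int[@empirical R X T x m]_(y in setT) (f y : R) = orbit_average f m.
Proof.
move=> fc fM; have fMc : continuous (fun y => f y + M).
  by move=> y; apply: cvgD; [exact: fc|exact: cvg_cst].
have fM0 y : 0 <= f y + M by have := fM y; rewrite ler_norml => /andP[]; lra.
pose em : probability (borel x) R := @empirical R X T x m.
have fint : em.-integrable setT (EFin \o (f : borel x -> R)).
  exact: bounded_continuous_integrable fc fM.
have Mint : em.-integrable setT (EFin \o (fun=> M)).
  by apply: (@bounded_continuous_integrable _ _ x em (fun=> M) `|M|) => // y; exact: cvg_cst.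
have intM : \int[em]_(y in setT) M = M.
  rewrite Rintegral_cst// (_ : (em : {measure set _ -> \bar R}) setT = 1%E) ?mulr1//.
  exact: probability_setT.
have mfM : measurable_fun setT (fun y : borel x => (f y + M)%:E).
  by apply/measurable_EFinP; exact: continuous_borel_measurable.
(* Adding M makes the integrand nonnegative, as the integration formulas for scaled and finite sums
   of measures require. *)
apply: (addIr M); rewrite -[in RHS](orbit_average_cst M m) -orbit_averageD.
rewrite -[X in _ + X = _]intM -RintegralD// /Rintegral.
rewrite [in LHS](_ : integral _ _ _ = (orbit_average (fun y => f y + M) m)%:E)//.
rewrite ge0_integral_mscale//; last by move=> y _; rewrite lee_fin.
rewrite ge0_integral_measure_sum//; last by move=> y _; rewrite lee_fin.
under eq_bigr do rewrite integral_dirac// diracE in_setT mul1e.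
rewrite sumEFin -EFinM /orbit_average /average big_add1/= big_mkord.
by [].
Qed.

End empirical_average.

Section ultrafilter_measure.
Context {R : realType} {X : metricType R} (T : X -> X) (x : X).
Hypothesis cptX : compact [set: X].
Hypothesis Tc : continuous T.
Variable U : set_system nat.
Hypothesis UU : UltraFilter U.
Hypothesis U_oo : U --> \oo.

Definition orbit_limit (f : X -> R) : R := lim (orbit_average T x f m @[m --> U]).

Local Notation L := orbit_limit.

Lemma cvg_orbit_limit (f : X -> R) : continuous f ->
  orbit_average T x f m @[m --> U] --> L f.
Proof.
move=> fc; have [M _ fM] := compact_continuous_bounded cptX fc.
by apply: (ultra_bounded_cvg (M := M%:R)) => m; exact: norm_orbit_average.
Qed.

Lemma orbit_limit_eq (f : X -> R) l : orbit_average T x f m @[m --> U] --> l -> L f = l.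
Proof. by move=> /cvg_lim; apply; exact: Rhausdorff. Qed.

Lemma orbit_limit_positive : positive_functional L.
Proof.
split.
- move=> f g fc gc; apply: orbit_limit_eq; under eq_fun do rewrite orbit_averageD.
  by apply: cvgD; exact: cvg_orbit_limit.
- move=> c f fc; apply: orbit_limit_eq; under eq_fun do rewrite orbit_averageZ.
  by apply: cvgM; [exact: cvg_cst|exact: cvg_orbit_limit].
- move=> f fc f0; apply: limr_ge.
    by apply/cvg_ex; exists (L f); exact: cvg_orbit_limit.
  by apply: nearW => m; rewrite -(orbit_average_cst T x 0 m) le_orbit_average.
- by apply: orbit_limit_eq; under eq_fun do rewrite orbit_average_cst; exact: cvg_cst.
Qed.

Lemma orbit_limit_invariant (f : X -> R) : continuous f -> L (f \o T) = L f.
Proof.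
move=> fc; have [M _ fM] := compact_continuous_bounded cptX fc.
have diff : orbit_average T x f m - orbit_average T x (f \o T) m @[m --> U] --> (0 : R).
  by move=> A A0; apply: U_oo; exact: (orbit_average_invariant _ _ fM).
apply: orbit_limit_eq; rewrite -[L f]subr0.
apply: cvg_trans (cvgB (cvg_orbit_limit fc) diff).
by apply: near_eq_cvg; apply: nearW => m /=; rewrite subKr.
Qed.

(** P represents the limit of orbit averages along U, so the empirical measures converge weakly to P
    along U; as U refines infinity, P is a cluster point of the whole sequence. The last clause is
    the form of outer regularity by which small P-mass of a closed set is read back on orbit
    averages. *)
Lemma ultrafilter_measure : exists P : probability (borel x) R,
  [/\ cluster ((fun m => (@empirical R X T x m : probability (borel x) R)
                        : @weak_probability R X x) @ \oo) (P : @weak_probability R X x),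
    forall A : set (borel x), measurable A -> P (T @^-1` A) = P A &
    forall (B : set X) (c : R), closed B -> (P B < c%:E)%E ->
      exists h : X -> R, [/\ continuous h, forall y, 0 <= h y, L h <= c &
        forall y, B y -> 2^-1 <= h y]].
Proof.
have [P PE] := daniell_probability x cptX orbit_limit_positive.
exists P; split.
- have int_cvg : forall f : continuousType X R,
      integrals (@empirical R X T x m : probability (borel x) R) f @[m --> U]
        --> integrals P f.
    move=> f; have fc : continuous f by exact: cts_fun.
    have [M _ fM] := compact_continuous_bounded cptX fc.
    rewrite /integrals (daniell_integral cptX orbit_limit_positive PE fc).
    under eq_fun do rewrite (Rintegral_empirical _ _ _ fc fM).
    exact: cvg_orbit_limit.
  have weak_cvg : (fun m => (@empirical R X T x m : probability (borel x) R)
      : @weak_probability R X x) @ U --> (P : @weak_probability R X x).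
    have ptws_cvg : (fun m => integrals (@empirical R X T x m : probability (borel x) R))
        @ U --> integrals P.
      rewrite cvg_sup => f.
      rewrite cvg_image; last by rewrite eqEsubset; split => v // _; exists (cst v).
      move=> A /int_cvg UA.
      exists (@^~ f @^-1` A) => //.
      by rewrite eqEsubset; split => [v [g + <-]//|v Av]; exists (cst v).
    move=> A [_ [[B oB <-] PB] BA].
    have /ptws_cvg UB : nbhs (integrals P) B by exact: open_nbhs_nbhs.
    by apply: (@filterS _ U _ _ _ _ UB) => m; exact: BA.
  move=> A B ooA PB.
  have UA : U ((fun m => (@empirical R X T x m : probability (borel x) R)
      : @weak_probability R X x) @^-1` A) by exact: U_oo.
  have UB : U ((fun m => (@empirical R X T x m : probability (borel x) R)
      : @weak_probability R X x) @^-1` B) by exact: weak_cvg.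
  by have [m [Am Bm]] := filter_ex (filterI UA UB); exact: (ex_intro _ _ (conj Am Bm)).
- move=> A mA; apply: (daniell_invariant PE Tc _ mA).
  exact: orbit_limit_invariant.
- move=> B c clB; rewrite PE => /daniell_measure_lt covB.
  have half : 0 < 2^-1 :> R by rewrite invr_gt0.
  have [h [hc h0 hc_le hB]] := covered_closed cptX clB covB half.
  by exists h; split => // y /hB; lra.
Qed.

End ultrafilter_measure.

(** * From Chowla's condition to completely deterministic points *)

Section Ch_S_strong.
Context {R : realType}.

Lemma level_partition (X : topologicalType) (x : X) (f : X -> R) (e : R) :
  continuous f -> (forall y, `|f y| <= 1) -> 0 < e ->
  exists k (P : 'I_k -> set (borel x)) (c : 'I_k -> R), [/\ measurable_partition P,
    forall j, `|c j| <= 1 & forall j y, P j y -> `|f y - c j| < e].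
Proof.
move=> fc f1 e0; pose K := (Num.truncn e^-1).+1.
have K0 : 0 < K%:R :> R by rewrite ltr0n.
have Ke : e^-1 < K%:R := truncnS_gt _.
pose s (y : X) := (f y + 1) * K%:R.
have f_bd y : - 1 <= f y <= 1 by rewrite -ler_norml.
have s0 y : 0 <= s y by have /andP[] := f_bd y; rewrite /s; nra.
have sK y : s y < (K.*2.+1)%:R.
  by have /andP[] := f_bd y; rewrite /s -natr1 -muln2 natrM; nra.
have sc : continuous s.
  move=> y; apply: cvgM; last exact: cvg_cst.
  by apply: cvgD; [exact: fc|exact: cvg_cst].
(* There are 2 K + 1 levels because s reaches 2 K where f = 1. *)
pose P (j : 'I_K.*2.+1) : set (borel x) := [set y | Num.truncn (s y) = j].
have PE (j : 'I_K.*2.+1) y : P j y -> j%:R <= s y < j.+1%:R.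
  by rewrite /P /= => <-; exact: truncn_itv.
pose c (j : 'I_K.*2.+1) : R := j%:R / K%:R - 1.
exists K.*2.+1, P, c; split.
- split.
  + move=> j; have -> : P j = s @^-1` [set` `[j%:R, j.+1%:R[].
      apply/seteqP; split => y; rewrite /preimage /= in_itv/=; first exact: PE.
      by rewrite -truncn_eq// => /eqP.
    rewrite -[X in measurable X]setTI.
    by apply: (continuous_borel_measurable sc) => //; exact: measurable_itv.
  + by apply/trivIsetP => i j _ _ ij; rewrite -subset0 => y [Pi Pj];
      move: ij; rewrite -(val_inj (etrans (esym Pi) Pj)) eqxx.
  + rewrite -subTset => y _; have yK : (Num.truncn (s y) < K.*2.+1)%N.
      by rewrite truncn_lt_nat.
    by exists (Ordinal yK).
- move=> j; rewrite /c ler_norml; have jK : j%:R <= 2 * K%:R :> R.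
    by rewrite -natrM mul2n ler_nat -ltnS.
  have : j%:R / K%:R <= 2 :> R by rewrite ler_pdivrMr.
  have : 0 <= j%:R / K%:R :> R by rewrite divr_ge0.
  by lra.
- move=> j y /PE; rewrite -natr1 => /andP[js sj].
  have -> : f y - c j = (s y - j%:R) / K%:R.
    by rewrite /c /s mulrBl mulfK ?gt_eqF//; lra.
  rewrite normrM ger0_norm ?subr_ge0// gtr0_norm ?invr_gt0//.
  rewrite ltr_pdivrMr// (lt_trans (y := 1))//; first by lra.
  by rewrite mulrC -ltr_pdivrMr// div1r.
Qed.

Theorem Ch_S_strong (z : int -> R) :
  (forall n : nat, (0 < n)%N -> z n \in [:: -1; 0; 1]) ->
  Ch z -> S_strong z.
Proof.
move=> z_sign chz X T cptX [Tc _] f fc x detx; move: f fc.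
apply: orthogonal_to_le1 => // f fc f1 r a i0 i adm.
set W := correlation z a i0 i; pose g n := f (iter n T x).
rewrite -cvg_shiftS; apply/cvgrPdist_le => d d0; apply: contrapT => notle.
(* If the averages exceed d infinitely often, an ultrafilter lives on the offending lengths;
   convergence along it is the contradiction sought. *)
have [U [UU U_far U_oo]] : exists U, [/\ UltraFilter U,
    U [set n | d < `|average (fun n => g n * W n) n.+1|] & U --> \oo].
  apply: frequently_ultra => near_le; apply: notle.
  by apply: filterS near_le => n; rewrite /= sub0r normrN => /negP; rewrite -leNgt.
have iter_c h : continuous (iter h T).
  by elim: h => [|h IH] y; [exact: cvg_id|apply: continuous_comp; [exact: IH|exact: Tc]].
have [P [clP P_inv P_closed]] := ultrafilter_measure x cptX Tc UU U_oo.
have ks0 := detx _ clP.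
have mT : measurable_fun setT (T : borel x -> borel x) by exact: continuous_borel_map.
have US_oo : n.+1 @[n --> U] --> \oo.
  by move=> A [n _ An]; apply: U_oo; exists n => // m /= nm; apply: An; exact: leqW.
suff : average (fun n => g n * W n) N @[N --> n.+1 @[n --> U]] --> (0 : R).
  move=> /cvgrPdist_le/(_ _ d0) close.
  have [n [/=]] := filter_ex (filterI U_far (close : U _)).
  by rewrite sub0r normrN ltNge => /negP.
apply: cvg_average_mul => //.
- by move=> n n0; exact: norm_correlation_le1.
- by move=> n; exact: f1.
- by move=> m S S0; exact: Ch_product.
move=> e e0 e1.
have [k [Q [c [partQ c1 Qc]]]] := level_partition x fc f1 e0.
(* kappa is half of the deviation rate e^2 / 8, and eta is chosen so that eta / kappa = e / 8,
   strictly below e / 4. *)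
pose kappa := e ^+ 2 / 16; have kappa0 : 0 < kappa by rewrite divr_gt0 ?exprn_gt0.
pose eta := kappa * (e / 8); have eta0 : 0 < eta by rewrite mulr_gt0// divr_gt0.
have [m [[m0 Hm] small_m]] : exists m : nat, ((0 < m)%N /\
    join_entropy (T : borel x -> borel x) P Q m <= eta * m%:R) /\
    expR (- (kappa * m%:R)) <= e.
  apply: (@filter_ex _ \oo); apply: filterI; last exact: expRN_small.
  by apply: filterI; [exact: nbhs_infty_gt|exact: join_entropy_sublinear].
have [G G_le PG] := few_words mT partQ m0 kappa0 Hm.
(* The value 0 beyond length m only keeps the words bounded by 1. *)
pose v (j : 'I_#|G|) (h : nat) : R :=
  if insub h is Some i then c (enum_val j i) else 0.
exists m, #|G|, v; split => //.
- by move=> j h; rewrite /v; case: insub => [i'|]; rewrite ?normr0.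
- rewrite (le_trans _ small_m)//.
  have -> : - (kappa * m%:R) = kappa * m%:R + - (e ^+ 2 * m%:R / 8).
    by rewrite /kappa; lra.
  by rewrite expRD ler_pM2r ?expR_gt0.
(* The complement of the good cells need not be closed, so it is replaced by the closed set of
   points at distance at least e from every good word at some time. B misses the good cells, where
   the distance is below e, and contains T^n x for every n far from the words. *)
pose B : set X := \bigcap_(w in [set` G]) \bigcup_(h in [set: 'I_m])
  [set y | e <= `|f (iter h T y) - c (w h)|].
have clB : closed B.
  apply: closed_bigI => w _; apply: closed_bigcup; first exact: finite_finset.
  move=> h _; apply: (@closed_comp _ _ (fun y => `|f (iter h T y) - c (w h)|)
    [set t | e <= t]); last exact: closed_ge.
  move=> y _; apply: cvg_norm; apply: cvgB; last exact: cvg_cst.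
  by apply: continuous_comp; [exact: iter_c|exact: fc].
have PB : (P B < (e / 4)%:E)%E.
  apply: le_lt_trans (_ : ((eta / kappa)%:E < _)%E); last first.
    by rewrite lte_fin /eta mulrAC divff ?gt_eqF// mul1r; lra.
  apply: le_trans PG; apply: le_measure.
  - by rewrite inE; exact: closed_borel.
  - rewrite inE; apply: measurableC; apply: fin_bigcup_measurable.
      exact: finite_finset.
    by move=> w _; exact: measurable_join_cell.
  - move=> y By [w wG wy]; have [h _] := By w wG.
    by rewrite /= leNgt => /negP; apply; apply: Qc; exact: wy.
(* Since h >= 1/2 on B, the density of far integers is at most twice the orbit average of h, which
   along U is eventually at most e / 4 + e / 4. *)
have [h [hc h0 Lh hB]] := P_closed B _ clB PB.
have := cvg_orbit_limit cptX UU (x := x) (T := T) hc => /cvgrPdist_le.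
have e4 : 0 < e / 4 by rewrite divr_gt0.
move=> /(_ _ e4) => near_h.
have : U (succn @^-1` [set N | average \1_(far_from g e m v) N <= e]).
  apply: filterS near_h => n /= hn.
  apply: (@le_trans _ _ (2 * orbit_average T x h n)); last first.
    by move: hn Lh; rewrite ler_norml => /andP[+ _]; lra.
  rewrite -orbit_averageZ; apply: ler_average => l _.
  rewrite indicE; have [far|_] := boolP (l \in _); last by rewrite mulr_ge0.
  rewrite -ler_pdivrMl// mulr1; apply: hB => w wG.
  have /set_mem/(_ (enum_rank_in wG w))[h' hm] := far.
  rewrite /v insubT enum_rankK_in// => eh; exists (Ordinal hm) => //=.
  by rewrite -iterD addnC; exact: ltW.
by [].
Qed.

End Ch_S_strong.

(** * The one-point system, tagged by R so that it carries a metric over R *)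

Definition one_point (R : realType) : Type := unit.

Section one_point.
Context {R : realType}.
Local Notation X := (one_point R).

HB.instance Definition _ := Choice.on X.
Let dist (x y : X) : R := 0.

Let dist_eq (x y : X) : dist x y = 0 -> x = y.
Proof. by case: x y => -[]. Qed.

Let dist_triangle (y x z : X) : dist x z <= dist x y + dist y z.
Proof. by rewrite addr0. Qed.

HB.instance Definition _ := @isMetric.Build R X dist (fun _ => erefl) dist_eq
  (fun _ _ => erefl) dist_triangle.

Lemma one_point_compact : compact [set: X].
Proof.
rewrite (_ : setT = [set (tt : X)]); first exact: compact_set1.
by apply/seteqP; split => -[].
Qed.

Lemma one_point_top_entropy : top_entropy (@id X) = 0%E.
Proof.
rewrite /top_entropy (_ : (fun _ : R => _) = cst 0%E).
  by apply: cvg_lim => //; exact: cvg_cst.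
apply/funext => e.
have sep1 n : max_separated (@id X) n e = 1%E.
  apply/eqP; rewrite eq_le; apply/andP; split.
    apply: ge_ereal_sup => _ [E _ <-]; rewrite lee_fin lern1.
    apply: (@leq_trans (#|` [fset (tt : X)]|)%fset); last by rewrite cardfs1.
    by apply: fsubset_leq_card; apply/fsubsetP => -[] _; rewrite inE.
  apply: ereal_sup_ubound; exists [fset (tt : X)]%fset; last by rewrite cardfs1.
  by move=> [] [] _ _; rewrite eqxx.
under eq_fun do rewrite sep1 lne1 mule0.
have cvg0 : (cst 0%E : nat -> \bar R) n @[n --> \oo] --> 0%E by exact: cvg_cst.
rewrite is_cvg_limn_esupE; last by apply/cvg_ex; exists 0%E.
exact: cvg_lim cvg0.
Qed.

Lemma one_point_ks_entropy (x : X) (nu : probability (borel x) R) :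
  ks_entropy (@id (borel x)) nu = 0%E.
Proof.
have set01 (A : set (borel x)) : A = set0 \/ A = setT.
  have [Att|Att] := pselect (A tt); [right|left].
    by apply/seteqP; split => // -[].
  by rewrite -subset0 => -[].
have entropy0 k (P : 'I_k -> set (borel x)) : partition_entropy (@id (borel x)) nu P = 0.
  rewrite /partition_entropy (_ : (fun n : nat => _) = cst 0) ?lim_cst//.
  apply/funext => n; rewrite /join_entropy big1 ?oppr0 ?mulr0// => w _.
  have [->|->] := set01 (join_cell id P w).
    by rewrite measure0 mul0r.
  by rewrite probability_setT/= ln1 mulr0.
apply/eqP; rewrite eq_le; apply/andP; split.
  by apply: ge_ereal_sup => _ [k [P [_ ->]]]; rewrite entropy0.
apply: ereal_sup_ubound; exists 1%N, (fun=> setT); split; last by rewrite entropy0.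
split => //; first by apply/trivIsetP => i j _ _; rewrite !ord1 eqxx.
by rewrite -subTset => y _; exists ord0.
Qed.

End one_point.

Theorem proposition4p19 (R : realType) (I : set int)
    (hI : I = [set n : int | 0 < n] \/ I = [set: int])
    (z : int -> R) (hz : forall n : int, I n -> z n \in [:: -1; 0; 1]) :
  (Ch z <-> S0_strong z) /\ (S0_strong z <-> S_strong z).
Proof.
(* Either choice of I contains the positive integers, the only arguments at which the averages
   evaluate z. *)
have z_sign (n : nat) : (0 < n)%N -> z n \in [:: -1; 0; 1].
  by move=> n0; apply: hz; case: hI => ->.
have id_homeo : homeomorphism (@id (one_point R)).
  by split => [y|]; [exact: cvg_id|exists id; split => // y; exact: cvg_id].
have orth_Ch : orthogonal_to z (@id (one_point R)) (fun=> 1) tt -> Ch z.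
  move=> orth r a i0 i /orth; under eq_fun do under eq_bigr do rewrite mul1r.
  by [].
have one_c : continuous (fun _ : one_point R => 1 : R) by exact: cst_continuous.
have S0_Ch : S0_strong z -> Ch z.
  move=> S0; apply: orth_Ch.
  exact: (S0 _ _ one_point_compact id_homeo one_point_top_entropy _ one_c).
have S_Ch : S_strong z -> Ch z.
  move=> S; apply: orth_Ch.
  have det : completely_deterministic R (@id (one_point R)) tt.
    by move=> nu _; exact: one_point_ks_entropy.
  exact: (S _ _ one_point_compact id_homeo _ one_c _ det).
have Ch_S0 := Ch_S0_strong z_sign; have Ch_S := Ch_S_strong z_sign.
by split; split => // [/S0_Ch/Ch_S|/S_Ch/Ch_S0].
Qed.
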